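(* For every integer $q\ge 2$ and every $\xi>0$ there exists $n_0\in\mathbb{N}$ such that the following holds whenever $n\ge n_0$ and $q\mid n$. Let $G$ be a $q$-graph on $n$ vertices such that (i) for some $d\ge\xi$, we have $(d-0.01\xi)n^{q-1}\le |G(v)|\le (d+0.01\xi)n^{q-1}$ for all $v\in V(G)$; (ii) every vertex is contained in at least $\xi n^{q}$ copies of $K^{(q)}_{q+1}$ in $G$; (iii) $|G(v)\cap G(w)|\ge \xi n^{q-1}$ for all $v,w\in V(G)$. Then $G$ contains $0.01\xi n^{q-1}$ pairwise edge-disjoint perfect matchings.
   Context: A $q$-graph is a hypergraph all of whose edges have size $q$, identified with its edge set. For a vertex $v$, $G(v)$ is the $(q-1)$-graph on $V(G)\setminus\{v\}$ whose edges are all sets $f$ with $f\cup\{v\}\in G$; $G(v)\cap G(w)$ is the set of common such $(q-1)$-sets. $K^{(q)}_{q+1}$ denotes the complete $q$-graph on $q+1$ vertices; a copy of it in $G$ is a $(q+1)$-set all of whose $q$-subsets are edges of $G$. *)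

(* Defs.v *)
From HB Require Import structures.
From mathcomp Require Import all_boot all_order all_algebra.
From mathcomp Require Import reals.

Set Implicit Arguments.
Unset Strict Implicit.
Unset Printing Implicit Defensive.

(* A hypergraph on the vertex set V is identified with its edge set. *)
Definition is_qgraph (V : finType) (q : nat) (G : {set {set V}}) : Prop :=
  forall e : {set V}, e \in G -> #|e| = q.

(* The graph G(v): its edges avoid v, so for a q-graph G they have size q - 1. *)
Definition link (V : finType) (G : {set {set V}}) (v : V) : {set {set V}} :=
  [set f : {set V} | (v \notin f) && (v |: f \in G)].

(* A copy of the complete q-graph on q+1 vertices is given by its vertex set. *)
Definition complete_copies (V : finType) (q : nat) (G : {set {set V}}) :
    {set {set V}} :=
  [set S : {set V} | (#|S| == q.+1) &&
     [forall e : {set V}, (e \subset S) && (#|e| == q) ==> (e \in G)]].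

Definition is_matching (V : finType) (G M : {set {set V}}) : Prop :=
  M \subset G /\ trivIset M.

Definition is_perfect_matching (V : finType) (G M : {set {set V}}) : Prop :=
  is_matching G M /\ cover M = [set: V].

(* Main.v *)
(* Perfect matchings can be extracted one after the other: removing a perfect
   matching lowers every vertex degree by exactly one, so after removing at most
   [xi / 100 n^(q-1)] of them the hypotheses survive with [xi / 2] for [xi].

   A single perfect matching is found by absorption.  If [f] lies in the links of
   both [v] and [w], then [v] can replace [w] in the edge [w |: f]; so an edge
   [w_1 .. w_q] together with common link sets [f_i] of [v_i] and [w_i] absorbs
   [v_1 .. v_q].  Disjoint absorbers are chosen one by one so as to decrease
   [sum_B 2^-(number of absorbers of B)] by a constant factor; after linearly many
   steps every [q]-set has linearly many absorbers.

   On the remaining vertices, moving weight inside copies of [K_(q+1)] makes all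
   weighted degrees equal while keeping the weight of each edge at most [2].
   A semi-random greedy argument then covers all but few vertices: edges are
   removed one at a time, each chosen not to increase by more than average the
   squared deviation [sum_v (deg v - c)^2] of the residual degrees from the value
   [c] predicted by the mean-field recursion [c' = c (1 - q (q - 1) / a)], [a] being
   the number of uncovered vertices.  Since all codegrees are [O(1/n)], this sum
   stays bounded, which forces an edge to exist as long as linearly many vertices
   are uncovered. *)
Require Import Defs.
From HB Require Import structures.
From mathcomp Require Import all_boot all_order all_algebra.
From mathcomp Require Import reals.
From mathcomp Require Import sequences exp.
From mathcomp Require Import ring lra zify.

Set Implicit Arguments.
Unset Strict Implicit.
Unset Printing Implicit Defensive.

Import Order.TTheory GRing.Theory Num.Theory.
Local Open Scope ring_scope.

(** * Sets covered exactly by a matching, and counts of supersets *)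

(** The matching is hidden so that pieces on disjoint vertex sets can be glued; the predicate is
    boolean so that it can restrict the index range of a sum. *)
Definition matchable (V : finType) (G : {set {set V}}) (A : {set V}) : bool :=
  [exists M : {set {set V}}, [&& M \subset G, trivIset M & cover M == A]].

Lemma matchableP (V : finType) (G : {set {set V}}) (A : {set V}) :
  reflect (exists M : {set {set V}}, [/\ M \subset G, trivIset M & cover M = A])
          (matchable G A).
Proof.
apply: (iffP existsP) => -[M].
  by case/and3P=> MG tM /eqP cM; exists M.
by case=> MG tM cM; exists M; rewrite MG tM cM eqxx.
Qed.

Lemma matchable0 (V : finType) (G : {set {set V}}) : matchable G set0.
Proof.
apply/matchableP; exists set0; split; first exact: sub0set.
  by apply/trivIsetP => A B; rewrite inE.
by rewrite /cover big_set0.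
Qed.

Lemma matchable1 (V : finType) (G : {set {set V}}) (e : {set V}) :
  e \in G -> matchable G e.
Proof.
move=> eG; apply/matchableP; exists [set e]; split; first by rewrite sub1set.
  by apply/trivIsetP => A B /set1P-> /set1P->; rewrite eqxx.
by rewrite /cover big_set1.
Qed.

Lemma matchableU (V : finType) (G : {set {set V}}) (A B : {set V}) :
  [disjoint A & B] -> matchable G A -> matchable G B -> matchable G (A :|: B).
Proof.
move=> dAB /matchableP[M [MG tM cM]] /matchableP[N [NG tN cN]].
apply/matchableP; exists (M :|: N); split; first by rewrite subUset MG.
  by apply: trivIsetU => //; rewrite cM cN.
by rewrite /cover bigcup_setU -/(cover M) -/(cover N) cM cN.
Qed.

Lemma matchable_dvdn (V : finType) (G : {set {set V}}) (q : nat) (A : {set V}) :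
  is_qgraph q G -> matchable G A -> (q %| #|A|)%N.
Proof.
move=> qG /matchableP[M [/subsetP MG /eqP tM <-]]; rewrite -tM.
by apply: dvdn_sum => e /MG/qG->.
Qed.

Lemma bin_le_expn (n k : nat) : ('C(n, k) <= n ^ k)%N.
Proof.
elim: k n => [|k IH] [|n] //.
rewrite -(@leq_pmul2l k.+1) // -mul_bin_diag expnS mulnCA.
rewrite leq_mul2l /= (leq_trans (IH n)) // (leq_trans _ (leq_pmull _ _)) //.
by case: k {IH} => // k; rewrite leq_exp2r.
Qed.

(** Deleting [B] maps these sets injectively into the sets of size [k - #|B|]. Taking [B] empty
    bounds the number of all [k]-sets. *)
Lemma card_supersets_le (V : finType) (k : nat) (B : {set V}) :
  (#|[set S : {set V} | (#|S| == k) && (B \subset S)]| <= #|V| ^ (k - #|B|))%N.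
Proof.
apply: leq_trans (bin_le_expn _ _); rewrite -card_draws.
rewrite -(@card_in_imset _ _ (fun S : {set V} => S :\: B)); last first.
  move=> S T; rewrite !inE => /andP[_ BS] /andP[_ BT] /= E.
  by rewrite -(setID S B) -(setID T B) E (setIidPr BS) (setIidPr BT).
apply/subset_leq_card/subsetP => _ /imsetP[S + ->].
by rewrite !inE => /andP[/eqP <- BS]; rewrite cardsD (setIidPr BS).
Qed.

(** * Almost perfect matchings *)

Definition wdeg (R : realFieldType) (V : finType) (w : {set V} -> R) (v : V) : R :=
  \sum_(e : {set V}) w e * (v \in e)%:R.

Definition wcodeg (R : realFieldType) (V : finType) (w : {set V} -> R)
    (u v : V) : R :=
  \sum_(e : {set V}) w e * (u \in e)%:R * (v \in e)%:R.

Lemma sum_mem_card (R : realFieldType) (V : finType) (B e : {set V}) :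
  \sum_(u in B) (u \in e)%:R = #|B :&: e|%:R :> R.
Proof.
rewrite -sum1_card natr_sum big_mkcond [RHS]big_mkcond /=.
by apply: eq_bigr => u _; rewrite inE; case: (u \in B); case: (u \in e).
Qed.

Lemma sum_wdeg (R : realFieldType) (V : finType) (w : {set V} -> R) (B : {set V}) :
  \sum_(u in B) wdeg w u = \sum_e w e * #|B :&: e|%:R.
Proof.
rewrite exchange_big; apply: eq_bigr => e _ /=.
by rewrite -mulr_sumr sum_mem_card.
Qed.

Lemma wcodegC (R : realFieldType) (V : finType) (w : {set V} -> R) (u v : V) :
  wcodeg w u v = wcodeg w v u.
Proof. by apply: eq_bigr => e _; rewrite mulrAC. Qed.

Lemma wcodeg_ge0 (R : realFieldType) (V : finType) (w : {set V} -> R) (u v : V) :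
  (forall e, 0 <= w e) -> 0 <= wcodeg w u v.
Proof. by move=> w0; apply: sumr_ge0 => e _; rewrite !mulr_ge0. Qed.

(* Bonferroni: [k - [k > 0]] is at most the number [k (k - 1)] of ordered pairs
   of distinct elements of [B] lying in the same edge. *)
Lemma hitting_weight_bounds (R : realFieldType) (V : finType) (w : {set V} -> R)
    (q : nat) (kappa : R) (B : {set V}) :
  (forall e, 0 <= w e) -> 0 <= kappa -> (#|B| <= q)%N ->
  (forall u v, u != v -> wcodeg w u v <= kappa) ->
  let H := \sum_e w e * (B :&: e != set0)%:R in
  H <= \sum_(u in B) wdeg w u /\
  \sum_(u in B) wdeg w u - H <= (q ^ 2)%:R * kappa.
Proof.
move=> w0 k0 Bq codk H; rewrite sum_wdeg; split.
  apply: ler_sum => e _; apply: ler_wpM2l => //.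
  by rewrite ler_nat -cards_eq0; case: #|_|.
rewrite -sumrB.
apply: (@le_trans _ _ (\sum_(u in B) \sum_(v in B :\ u) wcodeg w u v)).
  have -> : \sum_(u in B) \sum_(v in B :\ u) wcodeg w u v =
      \sum_e w e * (\sum_(u in B) (u \in e)%:R * \sum_(v in B :\ u) (v \in e)%:R).
    under eq_bigr do rewrite exchange_big /=.
    rewrite exchange_big /=; apply: eq_bigr => e _; rewrite mulr_sumr.
    by apply: eq_bigr => u _; rewrite mulrA mulr_sumr.
  apply: ler_sum => e _; rewrite -mulrBr; apply: ler_wpM2l => //.
  under eq_bigr do rewrite sum_mem_card.
  rewrite (eq_bigr (fun u => (u \in e)%:R * (#|B :&: e|%:R - 1))); last first.
    move=> u uB; case: (boolP (u \in e)) => [ue|]; last by rewrite !mul0r.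
    by rewrite !mul1r (cardsD1 u (B :&: e)) !inE uB ue natrD addrC addKr setIDAC.
  rewrite -mulr_suml sum_mem_card -cards_eq0.
  case: #|B :&: e| => [|k] /=; first by rewrite mul0r subr0.
  by rewrite -natr1 addrK natr1 -natrM ler_nat leq_pmull.
apply: (@le_trans _ _ (\sum_(u in B) \sum_(v in B :\ u) kappa)).
  apply: ler_sum => u _; apply: ler_sum => v; rewrite !inE => /andP[vu _].
  by apply: codk; rewrite eq_sym.
apply: (@le_trans _ _ (\sum_(u in B) q%:R * kappa)).
  apply: ler_sum => u _; rewrite sumr_const mulr_natl ler_wpMn2l //.
  by apply: leq_trans Bq; rewrite subset_leq_card // subD1set.
by rewrite sumr_const !mulr_natl -mulrnA ler_wpMn2l // leq_mul.
Qed.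

(** First-moment argument with unnormalised weights. Positivity of [p i] ensures that the chosen
    element lies in the support, hence is an actual edge later. *)
Lemma exists_le_weighted_average (R : realFieldType) (I : finType) (p F : I -> R)
    (c : R) :
  (forall i, 0 <= p i) -> 0 < \sum_i p i ->
  \sum_i p i * F i <= c * \sum_i p i -> exists i, 0 < p i /\ F i <= c.
Proof.
move=> p0 sp le_avg.
have [i /andP[]|no] := pickP (fun i => (0 < p i) && (F i <= c)); first by exists i.
have t0 i : 0 <= p i * (F i - c).
  have := no i; rewrite lt_def p0 andbT /=; case: eqP => [->|_ /= /negbT].
    by rewrite mul0r.
  by rewrite -ltNge => /ltW cF; rewrite mulr_ge0 ?subr_ge0.
have s0 : \sum_i p i * (F i - c) = 0.
  apply/eqP; rewrite eq_le sumr_ge0 ?andbT //.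
  under eq_bigr do rewrite mulrBr.
  by rewrite sumrB -mulr_suml subr_le0 mulrC.
have [i|z] := pickP (fun i => p i != 0); last first.
  by move: sp; rewrite big1 ?ltxx // => i _; apply/eqP/negbFE/z.
have := no i; rewrite lt_def p0 andbT /= => + pi0; rewrite pi0 /= => Fc.
have /eqP := psumr_eq0P (fun i _ => t0 i) s0 (i := i) isT.
by rewrite mulf_eq0 (negbTE pi0) subr_eq0 /= => /eqP E; rewrite E lexx in Fc.
Qed.

Lemma sum_wcodeg (R : realFieldType) (V : finType) (w : {set V} -> R)
    (q : nat) (A : {set V}) (v : V) :
  (forall e, w e != 0 -> #|e| = q /\ e \subset A) ->
  \sum_(u in A :\ v) wcodeg w u v = q.-1%:R * wdeg w v.
Proof.
move=> supp; rewrite exchange_big mulr_sumr; apply: eq_bigr => e _ /=.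
rewrite -mulr_suml -mulr_sumr sum_mem_card.
have [->|/supp[eq eA]] := eqVneq (w e) 0; first by rewrite !(mul0r, mulr0).
case: (boolP (v \in e)) => ve; last by rewrite !mulr0.
by rewrite setIC setIDA (setIidPl eA) -eq (cardsD1 v e) ve !mulr1 mulrC.
Qed.

Lemma sum_wdeg_uniform (R : realFieldType) (V : finType) (w : {set V} -> R)
    (q : nat) (A : {set V}) :
  (forall e, w e != 0 -> #|e| = q /\ e \subset A) ->
  \sum_(v in A) wdeg w v = q%:R * \sum_e w e.
Proof.
move=> supp; rewrite sum_wdeg mulr_sumr; apply: eq_bigr => e _.
have [->|/supp[eq eA]] := eqVneq (w e) 0; first by rewrite mul0r mulr0.
by rewrite (setIidPr eA) eq mulrC.
Qed.

(** Cauchy-Schwarz, from the fact that [#|A|] times the difference of the two sides is the sum of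
    the squares of [#|A| * F v - s]. *)
Lemma sqr_sum_le (R : realFieldType) (V : finType) (A : {set V}) (F : V -> R) :
  (\sum_(v in A) F v) ^+ 2 <= #|A|%:R * \sum_(v in A) F v ^+ 2.
Proof.
set s := \sum_(v in A) F v.
have [A0|An0] := eqVneq A set0; first by rewrite /s A0 !big_set0 expr0n mulr0.
have a_gt0 : 0 < #|A|%:R :> R by rewrite ltr0n card_gt0.
rewrite -subr_ge0 -(pmulr_rge0 _ a_gt0).
suff -> : #|A|%:R * (#|A|%:R * (\sum_(v in A) F v ^+ 2) - s ^+ 2) =
    \sum_(v in A) (#|A|%:R * F v - s) ^+ 2.
  by apply: sumr_ge0 => v _; rewrite sqr_ge0.
under [RHS]eq_bigr do rewrite sqrrB exprMn.
rewrite big_split sumrB /= sumrMnl -mulr_suml -mulr_sumr -mulr_sumr -/s.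
by rewrite sumr_const -[s ^+ 2 *+ _]mulr_natl; ring.
Qed.

(* The left-hand side is the potential after the removal of [e]; the bound is the
   average of that potential when [e] is drawn with probability [w e / W].  With [r]
   the predicted decrease of [c], the terms in [sum_v (wdeg w v - c)] cancel up to
   sign by Cauchy-Schwarz. *)
Lemma nibble_step (R : realFieldType) (V : finType) (w : {set V} -> R) (q : nat)
    (kappa c : R) (A : {set V}) :
  (0 < q)%N -> (forall e, 0 <= w e) ->
  (forall e, w e != 0 -> #|e| = q /\ e \subset A) ->
  (forall v, wdeg w v <= 1) ->
  0 <= kappa -> (forall u v, u != v -> wcodeg w u v <= kappa) ->
  0 <= c -> 0 < \sum_e w e ->
  let a := #|A|%:R in
  let W := \sum_e w e in
  let Phi := \sum_(v in A) (wdeg w v - c) ^+ 2 in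
  let r := c * (q%:R * q.-1%:R) / a in
  exists e, 0 < w e /\
    \sum_(v in A :\: e)
      (wdeg (fun f => w f * [disjoint f & e]%:R) v - (c - r)) ^+ 2 <=
    Phi + (2 * q.-1%:R * Phi + (q ^ 2)%:R * kappa * (Phi + a)) / W
      + a * ((q%:R * kappa) ^+ 2 + r ^+ 2).
Proof.
move=> q0 w0 supp deg1 k0 codk c0 W0 a W Phi r; rewrite -/W in W0.
pose dl v := wdeg w v - c.
(* The degree that [v] outside [e] loses when all edges meeting [e] disappear. Using [e :\ v] keeps
   the quantity small for [v] in [e] too, so that it can be averaged over all [e]. *)
pose X v e := \sum_f w f * (v \in f)%:R * ((f :&: (e :\ v)) != set0)%:R.
pose Q v := \sum_e w e * X v e.
pose s := \sum_(v in A) dl v.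
have aW : \sum_(v in A) wdeg w v = q%:R * W := sum_wdeg_uniform supp.
have sE : s = q%:R * W - a * c.
  by rewrite /s sumrB aW sumr_const -[c *+ _]mulr_natl.
have a_gt0 : 0 < a.
  rewrite ltr0n lt0n; apply: contraTneq W0 => /eqP; rewrite cards_eq0 => /eqP A0.
  have /eqP : q%:R * W = 0 by rewrite -aW A0 big_set0.
  by rewrite mulf_eq0 pnatr_eq0 eqn0Ngt q0 /= => /eqP->; rewrite ltxx.
have X_ge0 v e : 0 <= X v e by apply: sumr_ge0 => f _; rewrite !mulr_ge0.
have X_le v e : w e != 0 -> X v e <= q%:R * kappa.
  move=> /supp[eq eA].
  apply: (@le_trans _ _ (\sum_(u in e :\ v) wcodeg w u v)).
    rewrite /wcodeg exchange_big; apply: ler_sum => f _ /=.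
    rewrite -mulr_suml -mulr_sumr sum_mem_card mulrAC ler_wpM2r // ler_wpM2l //.
    by rewrite setIC ler_nat -cards_eq0; case: #|_|.
  apply: (@le_trans _ _ (\sum_(u in e :\ v) kappa)).
    by apply: ler_sum => u; rewrite !inE => /andP[uv _]; apply: codk.
  rewrite sumr_const mulr_natl ler_wpMn2l // -eq.
  by rewrite subset_leq_card // subD1set.
(* [Q v / W] is the mean loss at [v]. Swapping sums turns [Q v] into a sum over edges [f] at [v] of
   the weight hitting [f :\ v]. Bonferroni replaces that weight by a sum of degrees [c + dl u];
   [E v] collects the overcount. *)
have [E [E_ge0 E_le QE]] : exists E : V -> R,
    [/\ forall v, 0 <= E v, forall v, E v <= (q ^ 2)%:R * kappa &
     forall v, Q v = q.-1%:R * c * wdeg w v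
                + \sum_(u in A :\ v) wcodeg w u v * dl u - E v].
  pose H B := \sum_e w e * (B :&: e != set0)%:R.
  pose err (B : {set V}) := \sum_(u in B) wdeg w u - H B.
  exists (fun v => \sum_f w f * (v \in f)%:R * err (f :\ v)); split.
  - move=> v; apply: sumr_ge0 => f _; rewrite !mulr_ge0 //.
    by rewrite subr_ge0; case: (hitting_weight_bounds w0 k0 (leqnn #|f :\ v|) codk).
  - move=> v; apply: (@le_trans _ _ (wdeg w v * ((q ^ 2)%:R * kappa))).
      rewrite mulr_suml; apply: ler_sum => f _.
      have [->|/supp[fq _]] := eqVneq (w f) 0; first by rewrite !mul0r.
      rewrite ler_wpM2l ?mulr_ge0 //.
      have fvq : (#|f :\ v| <= q)%N by rewrite -fq subset_leq_card // subD1set.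
      by case: (hitting_weight_bounds w0 k0 fvq codk).
    by rewrite ler_piMl // mulr_ge0.
  - move=> v.
    have -> : Q v = \sum_f w f * (v \in f)%:R * H (f :\ v).
      rewrite /Q /X; under eq_bigr do rewrite mulr_sumr.
      rewrite exchange_big; apply: eq_bigr => f _ /=; rewrite mulr_sumr.
      apply: eq_bigr => e _; rewrite mulrCA; congr (_ * (_ * _%:R)).
      by rewrite setIDA setIDAC.
    have HE (B : {set V}) : H B = \sum_(u in B) wdeg w u - err B.
      by rewrite /err opprB addrC subrK.
    under eq_bigr do rewrite HE mulrBr.
    rewrite sumrB; congr (_ - _).
    rewrite mulrAC -(sum_wcodeg v supp) mulr_suml -big_split /=.
    under [RHS]eq_bigr do rewrite -mulrDr /dl addrC subrK.
    under [RHS]eq_bigr do rewrite mulr_suml.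
    rewrite exchange_big; apply: eq_bigr => f _ /=.
    have [->|/supp[_ fA]] := eqVneq (w f) 0.
      by rewrite !mul0r big1 // => u _; rewrite !mul0r.
    rewrite mulr_sumr big_mkcond [RHS]big_mkcond; apply: eq_bigr => u _ /=.
    rewrite !inE; have [uf|uf] := boolP (u \in f).
      by rewrite (subsetP fA) // mulr1; case: ifP; rewrite ?andbT // => ->.
    by rewrite mulr0 !mul0r !andbF if_same.
have sumX : \sum_e w e * (\sum_(v in A) (dl v - X v e + r) ^+ 2) <=
   (Phi + (2 * q.-1%:R * Phi + (q ^ 2)%:R * kappa * (Phi + a)) / W
      + a * ((q%:R * kappa) ^+ 2 + r ^+ 2)) * W.
  pose B0 := (q%:R * kappa) ^+ 2 + r ^+ 2.
  pose T v := \sum_(u in A :\ v) wcodeg w u v * dl u.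
  (* Expand the square around [dl v]. As [X v e] and [r] are nonnegative, [(X v e - r) ^+ 2] is at
     most the sum of their squares, bounded by [B0]. *)
  have per_vertex v : \sum_e w e * (dl v - X v e + r) ^+ 2 <=
      W * dl v ^+ 2 - 2 * dl v * (Q v - r * W) + W * B0.
    have -> : W * dl v ^+ 2 - 2 * dl v * (Q v - r * W) + W * B0 =
        \sum_e w e * (dl v ^+ 2 - 2 * dl v * (X v e - r) + B0).
      rewrite [RHS](eq_bigr (fun e => w e * dl v ^+ 2 - 2 * dl v * (w e * X v e)
        + 2 * dl v * r * w e + w e * B0)); last by move=> e _; ring.
      rewrite !big_split sumrN /= -!mulr_suml -!mulr_sumr -/W -/(Q v); ring.
    apply: ler_sum => e _.
    have [->|we] := eqVneq (w e) 0; first by rewrite !mul0r.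
    rewrite ler_wpM2l // /B0.
    have := X_le v e we; have := X_ge0 v e; have r0 : 0 <= r.
      by rewrite /r !mulr_ge0 // invr_ge0 ltW.
    move: (X v e) (q%:R * kappa) => x k x0 xk.
    have : x ^+ 2 <= k ^+ 2 by rewrite ler_sqr ?nnegrE // (le_trans x0).
    have : 0 <= x * r by rewrite mulr_ge0.
    nra.
  have s2 : s ^+ 2 <= a * Phi := sqr_sum_le A dl.
  have Phi_ge0 : 0 <= Phi by apply: sumr_ge0 => v _; rewrite sqr_ge0.
  have swap : \sum_(v in A) \sum_(u in A :\ v) wcodeg w u v * dl u ^+ 2 =
      \sum_(v in A) \sum_(u in A :\ v) wcodeg w u v * dl v ^+ 2.
    rewrite (exchange_big_dep (mem A)) /=; last first.
      by move=> v u _; rewrite !inE => /andP[].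
    apply: eq_bigr => u uA; apply: eq_big => [v|v _]; last by rewrite wcodegC.
    by rewrite !inE uA andbT eq_sym andbC.
  have diag : \sum_(v in A) \sum_(u in A :\ v) wcodeg w u v * dl v ^+ 2 <=
      q.-1%:R * Phi.
    rewrite mulr_sumr; apply: ler_sum => v _.
    rewrite -mulr_suml (sum_wcodeg v supp) ler_wpM2r ?sqr_ge0 //.
    by rewrite ler_piMr.
  (* Apply [- 2xy <= x^2 + y^2] to each pair, weighted by its codegree. By symmetry both squares sum
     to the quantity bounded in [diag]. *)
  have dlT : - (2 * \sum_(v in A) dl v * T v) <= 2 * q.-1%:R * Phi.
    apply: (@le_trans _ _ (\sum_(v in A) \sum_(u in A :\ v)
       (wcodeg w u v * dl v ^+ 2 + wcodeg w u v * dl u ^+ 2))).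
      rewrite mulr_sumr -sumrN; apply: ler_sum => v _.
      rewrite /T !mulr_sumr -sumrN; apply: ler_sum => u _.
      have := wcodeg_ge0 u v w0; move: (wcodeg w u v) (dl u) (dl v) => k x y kk.
      have : 0 <= k * (x + y) ^+ 2 by rewrite mulr_ge0 ?sqr_ge0.
      nra.
    under eq_bigr do rewrite big_split /=.
    by rewrite big_split /= swap; lra.
  have dlE : 2 * \sum_(v in A) dl v * E v <= (q ^ 2)%:R * kappa * (Phi + a).
    have -> : (q ^ 2)%:R * kappa * (Phi + a) =
        \sum_(v in A) (q ^ 2)%:R * kappa * (dl v ^+ 2 + 1).
      by rewrite -mulr_sumr big_split sumr_const.
    rewrite mulr_sumr; apply: ler_sum => v _.
    have := E_ge0 v; have := E_le v.
    move: (E v) (dl v) (_ * kappa) => x y k xk x0.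
    have : 0 <= x * (y - 1) ^+ 2 by rewrite mulr_ge0 ?sqr_ge0.
    have : 0 <= (k - x) * (y ^+ 2 + 1) by rewrite mulr_ge0 ?subr_ge0 ?addr_ge0 ?sqr_ge0.
    nra.
  under eq_bigr do rewrite mulr_sumr.
  rewrite exchange_big /=; apply: le_trans (ler_sum _ (fun v _ => per_vertex v)) _.
  rewrite big_split sumrB /= sumr_const -mulr_sumr -/Phi.
  have -> : \sum_(v in A) 2 * dl v * (Q v - r * W) =
      2 * q.-1%:R * c * Phi + 2 * q.-1%:R * c ^+ 2 * s
      + 2 * (\sum_(v in A) dl v * T v) - 2 * (\sum_(v in A) dl v * E v)
      - 2 * r * W * s.
    rewrite /Phi /s !mulr_sumr -!big_split -!sumrB /=.
    by apply: eq_bigr => v _; rewrite QE -/(T v) /dl -?mulr_sumr -/W; ring.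
  (* As [q W = a c + s], this makes [2 r W s] cancel the term linear in [s]. The remaining term in
     [s ^+ 2] is absorbed, through [key], by [- 2 (q - 1) c Phi]. *)
  have rW : r * W = q.-1%:R * c ^+ 2 + q.-1%:R * c * s / a.
    by rewrite sE /r; field; rewrite gt_eqF.
  have key : q.-1%:R * c * s ^+ 2 / a <= q.-1%:R * c * Phi.
    by rewrite ler_pdivrMr // -[leRHS]mulrA [Phi * a]mulrC ler_wpM2l ?mulr_ge0.
  rewrite -[W * B0 *+ _]mulr_natl -/a -/B0.
  have -> : 2 * r * W * s = 2 * q.-1%:R * c ^+ 2 * s + 2 * (q.-1%:R * c * s ^+ 2 / a).
    by rewrite -[2 * r * W]mulrA rW; ring.
  have -> : (Phi + (2 * q.-1%:R * Phi + (q ^ 2)%:R * kappa * (Phi + a)) / W + a * B0) * W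
     = W * Phi + 2 * q.-1%:R * Phi + (q ^ 2)%:R * kappa * (Phi + a) + a * (W * B0).
    by field; rewrite gt_eqF.
  by lra.
have [e [we le_e]] := exists_le_weighted_average w0 W0 sumX.
exists e; split => //; apply: le_trans le_e.
(* The average ran over all of [A]; the vertices of [e] leave, and their squares are dropped. *)
rewrite [leRHS](big_setID e) /= -[leLHS]add0r lerD //.
  by apply: sumr_ge0 => v _; rewrite sqr_ge0.
apply: ler_sum => v; rewrite inE => /andP[ve _].
suff -> : wdeg (fun f => w f * [disjoint f & e]%:R) v = wdeg w v - X v e.
  by rewrite /dl le_eqVlt; apply/orP; left; apply/eqP; ring.
rewrite /wdeg /X -sumrB; apply: eq_bigr => f _.
have -> : e :\ v = e by apply/setDidPl; rewrite disjoint_sym disjoints1.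
by rewrite -setI_eq0; case: eqP; rewrite /= ?mulr0 ?mulr1 ?subr0 ?subrr ?mul0r.
Qed.

(** * Estimates over linearly many greedy steps *)

Lemma exists_nat_ge (R : realType) (x : R) :
  exists N : nat, forall n : nat, (N <= n)%N -> x <= n%:R.
Proof.
exists (Num.bound `|x|) => n Nn; apply: (le_trans (ler_norm x)).
apply: (le_trans (ltW (archi_boundP (normr_ge0 x)))).
by rewrite ler_nat.
Qed.

(** From [1 + x <= expR x]. It keeps the potential bounded by a constant through up to [N] steps. *)
Lemma one_plus_div_exp_le (R : realType) (K : R) (N t : nat) :
  (0 < N)%N -> (t <= N)%N -> 0 <= K -> (1 + K / N%:R) ^+ t <= expR K.
Proof.
move=> N0 tN K0.
have [N1 KN] : 0 < N%:R :> R /\ 0 <= K / N%:R by rewrite divr_ge0 ?ltr0n.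
apply: (@le_trans _ _ (expR (K / N%:R) ^+ t)).
  by apply: lerXn2r; rewrite ?nnegrE ?expR_ge0 ?expR_ge1Dx // addr_ge0.
rewrite -expRM_natl ler_expR mulrCA ler_piMr // ler_pdivrMr // mul1r.
by rewrite ler_nat.
Qed.

(** For [0 <= x <= 1/2] the inverse of [1 - x] is at most [1 + 2x], which reduces to the previous
    bound. It keeps the predicted degree [c] away from zero. *)
Lemma one_minus_div_exp_ge (R : realType) (b : R) (N t : nat) :
  (0 < N)%N -> (t <= N)%N -> 0 <= b -> b / N%:R <= 1 / 2 ->
  expR (- (2 * b)) <= (1 - b / N%:R) ^+ t.
Proof.
move=> N0 tN b0 bN.
have pos : 0 < 1 - b / N%:R by lra.
rewrite expRN -[leRHS]invrK lef_pV2 ?posrE ?expR_gt0 ?invr_gt0 ?exprn_gt0 //.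
apply: le_trans (one_plus_div_exp_le N0 tN _); last by rewrite mulr_ge0.
rewrite -exprVn; apply: lerXn2r; rewrite ?nnegrE ?invr_ge0 ?(ltW pos) //.
  by rewrite addr_ge0 // divr_ge0 // mulr_ge0.
rewrite -[_^-1]mul1r ler_pdivrMr // -mulrA.
have : 0 <= b / N%:R by rewrite divr_ge0.
by nra.
Qed.

(** If all degrees were [c], then [q W] would equal [a c], with [a] the size of [A]. Cauchy-Schwarz
    bounds the discrepancy by [a c / 2], so at least half of that weight is present. *)
Lemma total_weight_ge (R : realFieldType) (V : finType) (w : {set V} -> R)
    (q : nat) (A : {set V}) (c : R) :
  (forall e, w e != 0 -> #|e| = q /\ e \subset A) -> 0 <= c ->
  4 * (\sum_(v in A) (wdeg w v - c) ^+ 2) <= #|A|%:R * c ^+ 2 ->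
  #|A|%:R * c <= 2 * q%:R * \sum_e w e.
Proof.
move=> supp c0 le_Phi; have := sqr_sum_le A (fun v => wdeg w v - c).
rewrite sumrB (sum_wdeg_uniform supp) sumr_const -[c *+ _]mulr_natl.
rewrite -[2 * q%:R * _]mulrA; move: (q%:R * _) le_Phi => W.
move: (\sum_(v in A) _) => Phi le_Phi le_s; rewrite leNgt; apply/negP => Wlt.
have a0 : 0 <= #|A|%:R :> R by [].
move: (#|A|%:R : R) a0 => a a0 in le_Phi le_s Wlt *.
have : 4 * (W - a * c) ^+ 2 <= (a * c) ^+ 2.
  apply: (@le_trans _ _ (a * (4 * Phi))); first by lra.
  by rewrite exprMn expr2 -mulrA ler_wpM2l.
have : 0 <= a * c by rewrite mulr_ge0.
move: (a * c) Wlt => m Wlt m0.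
have : m ^+ 2 < (2 * (m - W)) ^+ 2 by rewrite ltr_sqr ?nnegrE; lra.
nra.
Qed.

(** Passing to [Phi + 1] absorbs the additive errors, so that one step multiplies the potential by
    at most [1 + K / N] with a constant [K]. *)
Lemma nibble_error_bound (R : realFieldType) (N a q p kN C b W omega r Phi : R) :
  1 <= N -> 0 <= a -> a <= N -> 0 <= p -> p <= q -> kN = C / N -> 0 <= C ->
  0 < omega -> omega * N <= W -> 0 <= r -> r <= b / N -> 0 <= Phi ->
  Phi + (2 * p * Phi + q ^+ 2 * kN * (Phi + a)) / W + a * ((q * kN) ^+ 2 + r ^+ 2) + 1
  <= (Phi + 1) * (1 + (2 * q / omega + q ^+ 2 * C / omega + q ^+ 2 * C ^+ 2 + b ^+ 2) / N).
Proof.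
move=> N1 a0 aN p0 pq -> C0 om0 omW r0 rb Phi0.
have N0 : 0 < N by lra.
have omN : 0 < omega * N by rewrite mulr_gt0.
have W0 : 0 < W by lra.
have q0 : 0 <= q by lra.
have i1 : (2 * p * Phi + q ^+ 2 * (C / N) * (Phi + a)) / W <=
    (Phi + 1) * ((2 * q / omega + q ^+ 2 * C / omega) / N).
  have -> : (Phi + 1) * ((2 * q / omega + q ^+ 2 * C / omega) / N) =
     ((2 * q + q ^+ 2 * C) * (Phi + 1)) / (omega * N).
    by field; rewrite !gt_eqF.
  apply: (@le_trans _ _ (((2 * q + q ^+ 2 * C) * (Phi + 1)) / W)); last first.
    rewrite ler_wpM2l ?lef_pV2 ?posrE //.
    by rewrite mulr_ge0 ?addr_ge0 ?mulr_ge0 ?exprn_ge0 //; lra.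
  rewrite ler_wpM2r ?invr_ge0 ?(ltW W0) //.
  have : C / N * (Phi + a) <= C * (Phi + 1).
    rewrite -mulrA ler_wpM2l // mulrC ler_pdivrMr //.
    have : Phi <= Phi * N by rewrite ler_peMr.
    lra.
  have : p * Phi <= q * (Phi + 1).
    by apply: ler_pM => //; lra.
  move=> pq1 /(ler_wpM2l (sqr_ge0 q)); rewrite mulrA => qC1.
  by rewrite -[2 * p * Phi]mulrA; lra.
have i2 : a * ((q * (C / N)) ^+ 2 + r ^+ 2) <= (q ^+ 2 * C ^+ 2 + b ^+ 2) / N.
  have : r ^+ 2 <= (b / N) ^+ 2 by rewrite ler_sqr ?nnegrE // (le_trans r0).
  have -> : (q ^+ 2 * C ^+ 2 + b ^+ 2) / N = N * ((q * (C / N)) ^+ 2 + (b / N) ^+ 2).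
    by field; rewrite gt_eqF.
  move=> rb2; apply: ler_pM => //; first by rewrite addr_ge0 ?sqr_ge0.
  by rewrite lerD2l.
have n0 : 0 <= (q ^+ 2 * C ^+ 2 + b ^+ 2) / N.
  by rewrite divr_ge0 ?(ltW N0) // -exprMn addr_ge0 // sqr_ge0.
have : 0 <= Phi * ((q ^+ 2 * C ^+ 2 + b ^+ 2) / N) by rewrite mulr_ge0.
have -> : (2 * q / omega + q ^+ 2 * C / omega + q ^+ 2 * C ^+ 2 + b ^+ 2) / N =
   (2 * q / omega + q ^+ 2 * C / omega) / N + (q ^+ 2 * C ^+ 2 + b ^+ 2) / N.
  by rewrite -!mulrDl !addrA.
by rewrite !(mulrDr (Phi + 1)) mulr1 [(Phi + 1) * ((_ * _ + b ^+ 2) / N)]mulrDl; lra.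
Qed.

(** Surviving weights are not rescaled: degrees drift down as tracked by [c], while the codegree
    bounds of [w] are inherited. *)
Definition restr (R : realFieldType) (V : finType) (w : {set V} -> R)
    (A : {set V}) : {set V} -> R :=
  fun e => w e * (e \subset A)%:R.

Lemma restr_setD (R : realFieldType) (V : finType) (w : {set V} -> R)
    (A B e : {set V}) :
  restr w (A :\: B) e = restr w A e * [disjoint e & B]%:R.
Proof. by rewrite /restr subsetD -mulrA -natrM mulnb. Qed.

Lemma almost_perfect_matching (R : realType) (q : nat) (C delta : R) :
  (1 < q)%N -> 0 <= C -> 0 < delta ->
  exists N0 : nat, forall (V : finType) (G : {set {set V}}) (A0 : {set V})
    (w : {set V} -> R), (N0 <= #|A0|)%N ->
  (forall e, 0 <= w e) ->
  (forall e, w e != 0 -> [/\ e \in G, #|e| = q & e \subset A0]) ->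
  (forall v, v \in A0 -> wdeg w v = 1) ->
  (forall u v, u != v -> wcodeg w u v <= C / #|A0|%:R) ->
  exists A : {set V}, [/\ A \subset A0, #|A|%:R <= delta * #|A0|%:R &
    matchable G (A0 :\: A)].
Proof.
move=> q1 C0 d0; have q0 : (0 < q)%N by apply: ltnW.
have qR : 0 < q%:R :> R by rewrite ltr0n.
(* While [a > delta N], one step lowers [c] by a fraction at most [b / N], so [c >= cmin] for [N]
   steps, the total weight stays at least [omega N], and [K] is the constant of
   [nibble_error_bound]. *)
pose b : R := q%:R ^+ 2 / delta.
pose cmin : R := expR (- (2 * b)).
pose omega := delta * cmin / (2 * q%:R).
pose K := 2 * q%:R / omega + q%:R ^+ 2 * C / omega + q%:R ^+ 2 * C ^+ 2 + b ^+ 2.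
have b0 : 0 < b by rewrite divr_gt0 ?exprn_gt0.
have cmin0 : 0 < cmin by exact: expR_gt0.
have om0 : 0 < omega by rewrite divr_gt0 ?mulr_gt0.
have K0 : 0 <= K.
  have q2C : 0 <= q%:R ^+ 2 * C by rewrite mulr_ge0 ?sqr_ge0.
  rewrite /K -exprMn addr_ge0 ?sqr_ge0 // addr_ge0 ?sqr_ge0 //.
  by rewrite addr_ge0 // divr_ge0 ?(ltW om0) // mulr_ge0.
have [N1 N1P] := exists_nat_ge (2 * b).
(* Ensures [4 Phi <= a c^2] throughout, as [total_weight_ge] demands. *)
have [N2 N2P] := exists_nat_ge (4 * expR K / (delta * cmin ^+ 2)).
exists (maxn 1 (maxn N1 N2)) => V G A0 w.
rewrite !geq_max => /and3P[Npos /N1P NN1 /N2P NN2] w0 supp deg codeg.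
set N : R := #|A0|%:R in NN1 NN2 codeg *.
have N_gt0 : 0 < N by rewrite ltr0n.
have N_ge1 : 1 <= N by rewrite ler1n.
have bN : b / N <= 1 / 2 by rewrite ler_pdivrMr //; lra.
have {NN2} phiN : 4 * expR K <= delta * N * cmin ^+ 2.
  by rewrite mulrAC [leRHS]mulrC -ler_pdivrMr // mulr_gt0 // exprn_gt0.
pose Phi (A : {set V}) (c : R) : R := \sum_(v in A) (wdeg (restr w A) v - c) ^+ 2.
pose good (A : {set V}) := [/\ A \subset A0, #|A|%:R <= delta * N & matchable G (A0 :\: A)].
have restr0 A e : 0 <= restr w A e by rewrite mulr_ge0.
have restr_le A e : restr w A e <= w e by rewrite ler_piMr //; case: (_ \subset _).
have restr_supp A e : restr w A e != 0 -> [/\ e \in G, #|e| = q & e \subset A].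
  rewrite /restr mulf_eq0 negb_or pnatr_eq0 eqb0 negbK => /andP[/supp[eG eq _] eA].
  by split.
have step (t : nat) : (t <= #|A0|)%N -> (exists A, good A) \/
    exists (A : {set V}) (c : R), [/\ A \subset A0, (#|A| + q * t = #|A0|)%N,
      matchable G (A0 :\: A), (1 - b / N) ^+ t <= c <= 1 &
      Phi A c + 1 <= (1 + K / N) ^+ t].
  elim: t => [_|t IH tN].
    right; exists A0, 1; split; rewrite ?subxx ?muln0 ?addn0 ?setDv ?matchable0 //.
      by rewrite expr0 lexx.
    rewrite expr0 /Phi big1 ?add0r // => v vA0.
    suff -> : wdeg (restr w A0) v = 1 by rewrite subrr expr0n.
    rewrite -(deg v vA0); apply: eq_bigr => e _; congr (_ * _).
    have [we|/supp[_ _ eA0]] := eqVneq (w e) 0; first by rewrite /restr we mul0r.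
    by rewrite /restr eA0 mulr1.
  have [|[A [c [AA0 cardA mA /andP[c_ge c_le1] Phi_le]]]] := IH (ltnW tN).
    by left.
  have [small|big] := leP #|A|%:R (delta * N); first by left; exists A; split.
  right; set a : R := #|A|%:R in big.
  have a_gt0 : 0 < a by rewrite (lt_trans _ big) // mulr_gt0.
  have aN : a <= N by rewrite ler_nat subset_leq_card.
  have c_cmin : cmin <= c.
    by rewrite (le_trans _ c_ge) // one_minus_div_exp_ge ?(ltnW tN) // ltW.
  have c_gt0 : 0 < c by apply: lt_le_trans c_cmin.
  have Phi0 : 0 <= Phi A c by apply: sumr_ge0 => v _; exact: sqr_ge0.
  have Phi_expK : Phi A c <= expR K.
    have := one_plus_div_exp_le Npos (ltnW tN) K0; lra.
  pose W := \sum_e restr w A e.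
  have suppA e : restr w A e != 0 -> #|e| = q /\ e \subset A.
    by move=> /restr_supp[].
  have acW : a * c <= 2 * q%:R * W.
    apply: (total_weight_ge suppA (ltW c_gt0)).
    apply: (@le_trans _ _ (4 * expR K)); first by rewrite ler_wpM2l.
    apply: (le_trans phiN); apply: ler_pM; [| exact: sqr_ge0 | exact: ltW |].
      by rewrite mulr_ge0 // ltW.
    by rewrite ler_sqr ?nnegrE ?(ltW c_gt0) ?(ltW cmin0).
  have omW : omega * N <= W.
    have -> : omega * N = delta * N * cmin / (2 * q%:R) 
      by rewrite /omega; ring.
    rewrite ler_pdivrMr ?mulr_gt0 // [W * _]mulrC (le_trans _ acW) //.
    by apply: ler_pM => //; [rewrite mulr_ge0 // ltW | exact: ltW | exact: ltW].
  have W_gt0 : 0 < W by rewrite (lt_le_trans _ omW) // mulr_gt0.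
  have deg_le1 v : wdeg (restr w A) v <= 1.
    have [vA0|vA0] := boolP (v \in A0).
      by rewrite -(deg v vA0); apply: ler_sum => e _; rewrite ler_wpM2r.
    rewrite /wdeg big1 // => e _.
    have [->|/restr_supp[_ _ /subsetP eA]] := eqVneq (restr w A e) 0.
      by rewrite mul0r.
    have [/eA/(subsetP AA0) vA|_] := boolP (v \in e); last by rewrite mulr0.
    by rewrite vA in vA0.
  have codeg_le u v : u != v -> wcodeg (restr w A) u v <= C / N.
    move=> uv; apply: le_trans (codeg u v uv); apply: ler_sum => e _.
    by rewrite !ler_wpM2r.
  have kN0 : 0 <= C / N by rewrite divr_ge0 // ltW.
  have [e [we_gt0]] := nibble_step q0 (restr0 A) suppA deg_le1 kN0 codeg_le
    (ltW c_gt0) W_gt0.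
  rewrite -/a -/W -/(Phi A c); set r := c * _ / a => Phi'_le.
  have [eG eq eA] := restr_supp A e (lt0r_neq0 we_gt0).
  have r_ge0 : 0 <= r by rewrite /r divr_ge0 ?(ltW a_gt0) // mulr_ge0 ?(ltW c_gt0) // mulr_ge0.
  have r_le : r <= c * (b / N).
    rewrite /r -mulrA ler_wpM2l ?(ltW c_gt0) // ler_pdivrMr //.
    apply: (@le_trans _ _ (q%:R ^+ 2)).
      by rewrite expr2 ler_wpM2l // ler_nat leq_pred.
    apply: (@le_trans _ _ (b / N * (delta * N))); last first.
      by rewrite ler_wpM2l ?(ltW big) // divr_ge0 // ltW.
    by rewrite le_eqVlt /b; apply/orP; left; apply/eqP; field; rewrite !gt_eqF.
  have cAe : (#|A :\: e| + q = #|A|)%N.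
    by rewrite -eq -(cardsID e A) (setIidPr eA) addnC.
  exists (A :\: e), (c - r); split.
  - by rewrite (subset_trans _ AA0) // subsetDl.
  - by rewrite mulnS addnA cAe.
  - have -> : A0 :\: (A :\: e) = (A0 :\: A) :|: e.
      by rewrite setDDr (setIidPr (subset_trans eA AA0)).
    apply: matchableU mA (matchable1 eG).
    by rewrite disjoint_sym disjoints_subset (subset_trans eA) // setCD subsetUr.
  - apply/andP; split; last lra.
    rewrite exprS; apply: (@le_trans _ _ ((1 - b / N) * c)); last by lra.
    by rewrite ler_wpM2l //; lra.
  rewrite exprSr; apply: (@le_trans _ _ ((Phi A c + 1) * (1 + K / N))); last first.
    by rewrite ler_wpM2r // addr_ge0 // divr_ge0 // ltW.
  have rb : r <= b / N.
    by apply: (le_trans r_le); rewrite ler_piMl // divr_ge0 // ltW.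
  have pq : q.-1%:R <= q%:R :> R by rewrite ler_nat leq_pred.
  have := nibble_error_bound N_ge1 (ltW a_gt0) aN (ler0n _ _) pq (erefl (C / N)) C0
    om0 omW r_ge0 rb Phi0.
  apply: le_trans; rewrite lerD2r; move: Phi'_le; rewrite natrX; apply: le_trans.
  apply: ler_sum => v _; rewrite le_eqVlt; apply/orP; left; apply/eqP.
  by congr ((_ - _) ^+ 2); apply: eq_bigr => f _; rewrite restr_setD.
have [//|[A [c [AA0 cardA mA _ _]]]] := step _ (leqnn _).
(* The alternative is void after [N] steps: [#|A| + q N = N] contradicts [q >= 2] and [N >= 1]. *)
exists A; split => //; suff -> : #|A| = 0%N by rewrite mulr_ge0 ?ltW.
by have := leq_mul q1 (leqnn #|A0|); move: Npos cardA; clear; lia.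
Qed.

(** * Absorption *)

(** Union bound over the vertex of [T] that is hit. *)
Lemma card_hitting_le (V : finType) (k : nat) (T : {set V}) :
  (#|[set S : {set V} | (#|S| == k) && ~~ [disjoint S & T]]|
    <= #|T| * #|V| ^ k.-1)%N.
Proof.
have sub : [set S : {set V} | (#|S| == k) && ~~ [disjoint S & T]] \subset
    \bigcup_(x in T) [set S : {set V} | (#|S| == k) && ([set x] \subset S)].
  apply/subsetP => S; rewrite inE => /andP[Sk /pred0Pn[x /andP[xS xT]]].
  by apply/bigcupP; exists x; rewrite // inE Sk sub1set.
apply: leq_trans (subset_leq_card sub) _.
apply: (@leq_trans (\sum_(x in T) #|V| ^ k.-1)); last by rewrite sum_nat_const.
elim/big_rec2: _ => [|x m S xT le_Sm]; first by rewrite cards0.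
apply: leq_trans (leq_card_setU _ _) (leq_add _ le_Sm).
by apply: leq_trans (card_supersets_le k [set x]) _; rewrite cards1 subn1.
Qed.

(** Averaging against an upper bound [m] for the size of [L], since the candidate link sets are
    counted only up to [n^(q-1)]. *)
Lemma exists_ge_average (R : realFieldType) (I : finType) (L : {set I}) (F : I -> R)
    (m c : R) :
  L != set0 -> 0 <= c -> #|L|%:R <= m -> m * c <= \sum_(i in L) F i ->
  exists2 i, i \in L & c <= F i.
Proof.
move=> Ln0 c0 Lm le_sum.
have [i /andP[]|no] := pickP (fun i => (i \in L) && (c <= F i)); first by exists i.
have Fc i : i \in L -> F i < c by move=> iL; have := no i; rewrite iL ltNge /= => ->.
suff : \sum_(i in L) F i < m * c by rewrite ltNge le_sum.
apply: (@lt_le_trans _ _ (\sum_(i in L) c)).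
  have [i iL] := set0Pn _ Ln0.
  rewrite (bigD1 i) //= [ltRHS](bigD1 i) //= ltr_leD ?Fc // ler_sum // => j.
  by case/andP=> /Fc/ltW.
by rewrite sumr_const -mulr_natl ler_wpM2r.
Qed.

Lemma card_link_edge (V : finType) (G : {set {set V}}) (q : nat) (v : V) (f : {set V}) :
  is_qgraph q G -> f \in link G v -> #|f| = q.-1.
Proof. by move=> qG; rewrite inE => /andP[vf /qG <-]; rewrite cardsU1 vf. Qed.

Lemma card_link_le (V : finType) (G : {set {set V}}) (q : nat) (v : V) :
  is_qgraph q G -> (#|link G v| <= #|V| ^ q.-1)%N.
Proof.
move=> qG; have := card_supersets_le q.-1 (@set0 V); rewrite cards0 subn0.
apply: leq_trans; apply/subset_leq_card/subsetP => f /(card_link_edge qG) fq.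
by rewrite inE fq eqxx sub0set.
Qed.

(* Sets [B] meeting [S] count as absorbed, which spares the averaging below any
   disjointness condition between [B] and the absorber being built. *)
Definition absorbs (V : finType) (G : {set {set V}}) (S B : {set V}) : bool :=
  [disjoint S & B] ==> matchable G (S :|: B).

Lemma disjoint_setUl (V : finType) (A B C : {set V}) :
  [disjoint A :|: B & C] = [disjoint A & C] && [disjoint B & C].
Proof. by rewrite -!setI_eq0 setIUl setU_eq0. Qed.

Lemma disjoint_setUr (V : finType) (A B C : {set V}) :
  [disjoint A & B :|: C] = [disjoint A & B] && [disjoint A & C].
Proof. by rewrite -!setI_eq0 setIUr setU_eq0. Qed.

(** The enumeration of [B] orders its vertices: the new edge joins [f] to the vertex at position
    [k], which is disjoint from everything matched so far. *)
Lemma matchable_take_step (V : finType) (G : {set {set V}}) (x0 : V)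
    (B T f : {set V}) (k : nat) :
  (k < #|B|)%N -> [disjoint T & B] -> [disjoint f & B :|: T] ->
  f \in link G (nth x0 (enum B) k) ->
  matchable G ([set x in take k (enum B)] :|: T) ->
  matchable G ([set x in take k.+1 (enum B)] :|: (T :|: f)).
Proof.
set b := nth x0 (enum B) k => kB TB fBT; rewrite inE => /andP[bf bfG] mk.
have kE : (k < size (enum B))%N by rewrite -cardE.
have bB : b \in B by rewrite -mem_enum mem_nth.
have -> : [set x in take k.+1 (enum B)] :|: (T :|: f) =
    ([set x in take k (enum B)] :|: T) :|: (b |: f).
  apply/setP => x; rewrite (take_nth x0) // !inE mem_rcons inE -/b.
  by case: (x == b); case: (x \in take _ _); case: (x \in T); case: (x \in f).
apply: matchableU mk (matchable1 bfG).
rewrite disjoints_subset; apply/subsetP => x; rewrite !inE => /orP[xk|xT].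
  have xB : x \in B by rewrite -mem_enum (mem_take xk).
  rewrite negb_or; apply/andP; split; last first.
    by apply: contraL fBT => xf; apply/pred0Pn; exists x; rewrite /= xf inE xB.
  apply: contraL xk => /eqP ->; have := enum_uniq B.
  by rewrite -{1}(cat_take_drop k.+1 (enum B)) (take_nth x0) // cat_uniq rcons_uniq
    => /andP[/andP[]].
rewrite negb_or; apply/andP; split.
  by apply: contraL TB => /eqP xb; apply/pred0Pn; exists x; rewrite /= xT xb.
by apply: contraL fBT => xf; apply/pred0Pn; exists x; rewrite /= xf inE xT orbT.
Qed.

(* The common link sets are added to the absorber one vertex of [e] at a time, each
   keeping a proportion at least [zeta / 2] of the weight [beta]. *)
Lemma absorber_step (R : realFieldType) (V : finType) (G : {set {set V}}) (q : nat)
    (zeta : R) (X e : {set V}) (beta : {set V} -> R) :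
  (1 < q)%N -> is_qgraph q G -> 0 < zeta ->
  (forall v w : V, zeta * #|V|%:R ^+ q.-1 <= #|link G v :&: link G w|%:R) ->
  (#|X| + q ^ 2)%:R <= zeta / 2 * #|V|%:R ->
  (forall B, 0 <= beta B) -> e \in G -> [disjoint e & X] ->
  exists S : {set V}, [/\ #|S| = (q ^ 2)%N, [disjoint S & X], matchable G S &
    (zeta / 2) ^+ q * \sum_(B : {set V} | #|B| == q) beta B
      <= \sum_(B : {set V} | (#|B| == q) && absorbs G S B) beta B].
Proof.
move=> q1 qG z0 common smallX beta0 eG eX.
have eq := qG e eG.
have [x0 x0e] : exists x, x \in e by apply/set0Pn; rewrite -card_gt0 eq ltnW.
have V0 : 0 < #|V|%:R :> R by rewrite ltr0n (cardD1 x0).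
suff steps k : (k <= q)%N -> exists T : {set V},
    [/\ #|T| = (k * q.-1)%N, [disjoint T & X :|: e],
        matchable G ([set x in take k (enum e)] :|: T) &
    (zeta / 2) ^+ k * \sum_(B : {set V} | #|B| == q) beta B
      <= \sum_(B : {set V} | (#|B| == q) && ([disjoint T & B] ==>
            matchable G ([set x in take k (enum B)] :|: T))) beta B].
  have [T [cT TXe mT avgT]] := steps q (leqnn q).
  have enumq (B : {set V}) : #|B| = q -> [set x in take q (enum B)] = B.
    by move=> Bq; rewrite take_oversize -?cardE ?Bq // set_enum.
  move: TXe; rewrite disjoint_setUr => /andP[TX Te].
  have eT : [disjoint e & T] by rewrite disjoint_sym.
  (* Alone, [e :|: T] is tiled by joining the link sets to the vertices of [e]. Together with [B],
     they are joined to the vertices of [B] and [e] is used as an edge. The size is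
     [q + q (q - 1)]. *)
  exists (e :|: T); split.
  - rewrite cardsU (eqP (_ : e :&: T == set0)) ?setI_eq0 // cards0 subn0 eq cT.
    by rewrite expnS expn1 -{1}[q]muln1 -mulnDr add1n prednK // ltnW.
  - by rewrite disjoint_setUl eX.
  - by move: mT; rewrite enumq.
  apply: le_trans avgT _.
  rewrite [leLHS]big_mkcond [leRHS]big_mkcond; apply: ler_sum => B _ /=.
  have [Bq|//] := eqVneq; rewrite enumq //=.
  case: ifP => [impl|_]; last by case: ifP.
  rewrite ifT // /absorbs disjoint_setUl; apply/implyP => /andP[eB TB].
  rewrite -setUA; apply: matchableU (matchable1 eG) _.
    by rewrite disjoint_setUr eT.
  by rewrite setUC; move: impl; rewrite TB.
elim: k => [_|k IH kq].
  have start (B : {set V}) : matchable G ([set x in take 0 (enum B)] :|: set0).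
    have nil0 : [set x in [::]] = set0 :> {set V} by apply/setP => x; rewrite !inE.
    by rewrite take0 setU0 nil0 matchable0.
  exists set0; split; rewrite ?cards0 ?start // -?setI_eq0 ?set0I //.
  rewrite expr0 mul1r le_eqVlt; apply/orP; left; apply/eqP; apply: eq_bigl => B.
  by rewrite start implybT andbT.
have [T [cT TXe mT avgT]] := IH (ltnW kq).
pose Y := X :|: e :|: T.
pose nb (B : {set V}) := nth x0 (enum B) k.
pose L := [set f in link G (nb e) | [disjoint f & Y]].
have cY : (#|Y| <= #|X| + q ^ 2)%N.
  rewrite /Y -setUA (leq_trans (leq_card_setU _ _)) // leq_add2l.
  rewrite (leq_trans (leq_card_setU _ _)) // eq cT expnS expn1.
  have : (k * q.-1 <= q * q.-1)%N by rewrite leq_mul2r ltnW ?orbT.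
  by rewrite (_ : q * q = q + q * q.-1)%N ?leq_add2l // -mulnS prednK // ltnW.
have candidates (B : {set V}) :
    zeta / 2 * #|V|%:R ^+ q.-1 <= #|L :&: link G (nb B)|%:R.
  (* At most [#|Y| n^(q-2)] link sets meet the forbidden vertices, hence at least half of the
     guaranteed common link sets remain. *)
  have hit : #|(link G (nb e) :&: link G (nb B)) :\: L|%:R
      <= zeta / 2 * #|V|%:R ^+ q.-1.
    apply: (@le_trans _ _ (#|Y| * #|V| ^ q.-2)%:R).
      rewrite ler_nat; apply: leq_trans (card_hitting_le q.-1 Y).
      apply/subset_leq_card/subsetP => f; rewrite inE => /andP[fL].
      rewrite inE => /andP[fl _]; rewrite inE (card_link_edge qG fl) eqxx.
      by move: fL; rewrite inE fl.
    have -> : #|V|%:R ^+ q.-1 = #|V|%:R * #|V|%:R ^+ q.-2 :> R.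
      by rewrite -exprS; case: (q) q1 => [|[]].
    rewrite natrM natrX [leRHS]mulrA ler_wpM2r ?exprn_ge0 // (le_trans _ smallX) //.
    by rewrite ler_nat.
  have := common (nb e) (nb B); rewrite -(cardsID L) natrD => le_split.
  have -> : L :&: link G (nb B) = (link G (nb e) :&: link G (nb B)) :&: L.
    apply/setP => f; rewrite !in_setI; have [|_] := boolP (f \in L); last first.
      by rewrite andbF.
    by rewrite inE => /andP[-> _]; rewrite andbT.
  lra.
have L0 : L != set0.
  apply: contraTneq (candidates e) => ->.
  by rewrite set0I cards0 -ltNge mulr_gt0 ?exprn_gt0 // divr_gt0.
have Lle : #|L|%:R <= #|V|%:R ^+ q.-1 :> R.
  rewrite -natrX ler_nat (leq_trans _ (card_link_le (nb e) qG)) //.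
  by apply/subset_leq_card/subsetP => f; rewrite inE => /andP[].
pose ok (B : {set V}) := (#|B| == q) &&
  ([disjoint T & B] ==> matchable G ([set x in take k (enum B)] :|: T)).
have z20 : 0 <= zeta / 2 by rewrite divr_ge0 ?ltW.
have tot0 : 0 <= \sum_(B | ok B) beta B by rewrite sumr_ge0.
(* Double counting of pairs of a candidate [f] and a set [B] whose next vertex also has [f] in its
   link. *)
have avg : #|V|%:R ^+ q.-1 * (zeta / 2 * \sum_(B | ok B) beta B) <=
    \sum_(f in L) \sum_(B | ok B) beta B * (f \in link G (nb B))%:R.
  rewrite exchange_big mulrA [_ * (zeta / 2)]mulrC mulr_sumr.
  apply: ler_sum => B _; rewrite -mulr_sumr. rewrite [leLHS]mulrC ler_wpM2l //.
  by apply: le_trans (candidates B) _; rewrite setIC -sum1_card natr_sum /=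
     big_mkcond [leRHS]big_mkcond; apply: ler_sum => f _; rewrite inE;
     case: (f \in link _ _); case: (f \in L).
have [f fL avgf] := exists_ge_average L0 (mulr_ge0 z20 tot0) Lle avg.
move: fL; rewrite inE /Y !disjoint_setUr => /andP[fl /andP[/andP[fX fe] fT]].
move: TXe; rewrite disjoint_setUr => /andP[TX Te].
exists (T :|: f); split.
- rewrite cardsU (eqP (_ : T :&: f == set0)) ?setI_eq0 1?disjoint_sym //.
  by rewrite cards0 subn0 cT (card_link_edge qG fl) mulSn addnC.
- by rewrite disjoint_setUl !disjoint_setUr TX Te fX fe.
- by apply: (matchable_take_step (x0 := x0)); rewrite ?eq ?disjoint_setUr ?fe.
rewrite exprS -mulrA; apply: (@le_trans _ _ (zeta / 2 * \sum_(B | ok B) beta B)).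
  by rewrite ler_wpM2l.
apply: le_trans avgf _; rewrite big_mkcond [leRHS]big_mkcond.
apply: ler_sum => B _; rewrite /ok; have [Bq /=|//] := eqVneq.
case: ifP => [impl|_]; last by case: ifP.
have [fB|_] := boolP (f \in link _ _); last by rewrite mulr0; case: ifP.
rewrite ifT ?mulr1 //; apply/implyP; rewrite disjoint_setUl => /andP[TB fB'].
apply: (matchable_take_step (x0 := x0)); rewrite ?Bq ?disjoint_setUr ?fB' //.
by move: impl; rewrite TB.
Qed.

Lemma matchable_cover (V : finType) (G Ss : {set {set V}}) :
  trivIset Ss -> {in Ss, forall S, matchable G S} -> matchable G (cover Ss).
Proof.
have [n] := ubnP #|Ss|; elim: n Ss => // n IH Ss; rewrite ltnS => cS tS mS.
have [->|[S SS]] := set_0Vmem Ss; first by rewrite /cover big_set0 matchable0.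
have SsE : cover Ss = S :|: cover (Ss :\ S) by rewrite /cover (big_setD1 S).
rewrite SsE; apply: matchableU; last 1 first.
- apply: IH; last by move=> T /setD1P[_ /mS].
    by move: cS; rewrite (cardsD1 S) SS.
  by apply: trivIsetS tS; exact: subD1set.
- rewrite disjoint_sym disjoints_subset; apply/bigcupsP => T /setD1P[TS TSs].
  by rewrite -disjoints_subset (trivIsetP tS).
by apply: mS.
Qed.

Definition absorbers (V : finType) (G Ss : {set {set V}}) (B : {set V}) :
    {set {set V}} :=
  [set S in Ss | absorbs G S B].

Lemma absorption (V : finType) (G Ss : {set {set V}}) (q m : nat) (U : {set V}) :
  trivIset Ss -> {in Ss, forall S, matchable G S} -> [disjoint U & cover Ss] ->
  #|U| = (q * m)%N ->
  (forall B : {set V}, B \subset U -> #|B| = q -> (m <= #|absorbers G Ss B|)%N) ->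
  matchable G (U :|: cover Ss).
Proof.
elim: m Ss U => [|m IH] Ss U tS mS dU cU abs.
  move/eqP: cU; rewrite muln0 cards_eq0 => /eqP->; rewrite set0U.
  exact: matchable_cover.
pose B := [set x in take q (enum U)].
have BU : B \subset U.
  by apply/subsetP => x; rewrite inE => /mem_take; rewrite mem_enum.
have Bq : #|B| = q.
  rewrite cardsE (card_uniqP _) ?take_uniq ?enum_uniq // size_takel // -cardE cU.
  by rewrite leq_pmulr.
have [S] : exists S, S \in absorbers G Ss B.
  by apply/set0Pn; rewrite -card_gt0; apply: leq_trans (abs B BU Bq).
rewrite inE => /andP[SS absS].
have SsE : cover Ss = S :|: cover (Ss :\ S) by rewrite /cover (big_setD1 S).
have dS : [disjoint S & cover (Ss :\ S)].
  rewrite disjoint_sym disjoints_subset; apply/bigcupsP => T /setD1P[TS TSs].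
  by rewrite -disjoints_subset (trivIsetP tS).
move: dU; rewrite SsE disjoint_setUr => /andP[dUS dUS'].
have mSB : matchable G (S :|: B).
  by apply: (implyP absS); rewrite disjoint_sym; apply: disjointWl dUS.
have -> : U :|: (S :|: cover (Ss :\ S)) = (S :|: B) :|: ((U :\: B) :|: cover (Ss :\ S)).
  by rewrite -{1}(setID U B) (setIidPr BU) -!setUA [RHS]setUCA; congr (_ :|: _); rewrite setUCA.
apply: matchableU mSB _.
  rewrite disjoint_setUl !disjoint_setUr dS andbT; apply/and3P; split.
  - by rewrite disjoint_sym; apply: disjointWl dUS; exact: subsetDl.
  - by rewrite disjoints_subset setCD subsetUr.
  - exact: disjointWl dUS'.
apply: IH.
- by apply: trivIsetS tS; exact: subD1set.
- by move=> T /setD1P[_ /mS].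
- by apply: disjointWl dUS'; exact: subsetDl.
- by rewrite cardsD (setIidPr BU) Bq cU mulnS addKn.
move=> C CU Cq; rewrite -ltnS.
apply: leq_trans (abs C (subset_trans CU (subsetDl _ _)) Cq) _.
rewrite (cardsD1 S) -add1n leq_add ?leq_b1 // subset_leq_card //.
by apply/subsetP => T; rewrite !inE andbA.
Qed.

(** Choose [v] outside [X]. Fewer than [zeta n^(q-1)] of its link sets can meet [X], so one avoids
    it. *)
Lemma exists_edge_avoiding (R : realFieldType) (V : finType) (G : {set {set V}})
    (q : nat) (zeta : R) (X : {set V}) :
  (1 < q)%N -> is_qgraph q G -> 0 < zeta ->
  (forall v : V, zeta * #|V|%:R ^+ q.-1 <= #|link G v|%:R) ->
  #|X|%:R < zeta * #|V|%:R :> R -> exists2 e, e \in G & [disjoint e & X].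
Proof.
move=> q1 qG z0 deg Xsmall.
have V0 : (0 < #|V|)%N.
  by rewrite lt0n; apply: contraTneq Xsmall => ->; rewrite mulr0 -leNgt.
have V0R : 0 < #|V|%:R :> R by rewrite ltr0n.
have z1 : zeta <= 1.
  have /card_gt0P[x _] := V0; rewrite -(ler_pM2r (exprn_gt0 q.-1 V0R)) mul1r.
  by apply: le_trans (deg x) _; rewrite -natrX ler_nat card_link_le.
have [v vX] : exists v, v \notin X.
  apply/existsP; rewrite -negb_forall; apply: contraTN Xsmall => /forallP XT.
  rewrite -leNgt (_ : X = setT) ?cardsT; last by apply/setP => x; rewrite XT inE.
  by rewrite ler_piMl.
have [f fl fX] : exists2 f, f \in link G v & [disjoint f & X].
  apply/exists_inP; apply: contraLR Xsmall => /exists_inPn hit.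
  have : (#|link G v| <= #|X| * #|V| ^ q.-2)%N.
    apply: leq_trans (card_hitting_le q.-1 X).
    apply/subset_leq_card/subsetP => f fl.
    by rewrite inE (card_link_edge qG fl) eqxx hit.
  rewrite -(ler_nat R) natrM natrX -leNgt => le_link.
  rewrite -(ler_pM2r (exprn_gt0 q.-2 V0R)) -mulrA -exprS.
  apply: le_trans (le_link); rewrite (_ : q.-2.+1 = q.-1) ?deg //.
  by case: (q) q1 => [|[]].
move: fl; rewrite inE => /andP[_ vfG]; exists (v |: f) => //.
by rewrite disjoint_setUl fX andbT disjoints1.
Qed.

(** The potential starts at most [n^q]. A new absorber halves the term of each [B] it absorbs, and
    these carry a fraction at least [c] of the total, whence the factor [1 - c / 2]. The size
    condition leaves room for each new absorber. *)
Lemma absorbing_family (R : realFieldType) (V : finType) (G : {set {set V}}) (q : nat)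
    (zeta : R) (s : nat) :
  (1 < q)%N -> is_qgraph q G -> 0 < zeta <= 1 ->
  (forall v w : V, zeta * #|V|%:R ^+ q.-1 <= #|link G v :&: link G w|%:R) ->
  (s.+1 * q ^ 2)%:R <= zeta / 2 * #|V|%:R ->
  exists Ss : {set {set V}}, [/\ #|Ss| = s, trivIset Ss,
    forall S, S \in Ss -> #|S| = (q ^ 2)%N /\ matchable G S &
    \sum_(B : {set V} | #|B| == q) (1 / 2 : R) ^+ #|absorbers G Ss B|
      <= (1 - (zeta / 2) ^+ q / 2) ^+ s * #|V|%:R ^+ q].
Proof.
move=> q1 qG /andP[z0 z1] common.
pose c := (zeta / 2) ^+ q.
have c0 : 0 < c by rewrite exprn_gt0 // divr_gt0.
have c1 : c <= 1 by rewrite exprn_ile1 // ?divr_ge0 ?(ltW z0) //; lra.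
elim: s => [_|s IH sV].
  exists set0; split; rewrite ?cards0 //.
  - by apply/trivIsetP => A B; rewrite inE.
  - by move=> S; rewrite inE.
  rewrite expr0 [leRHS]mul1r -natrX.
  apply: (@le_trans _ _ (\sum_(B : {set V} | #|B| == q) 1)).
    by apply: ler_sum => B _; apply: exprn_ile1; lra.
  rewrite sumr_const ler_nat; have := card_supersets_le q (@set0 V).
  rewrite cards0 subn0; apply: leq_trans; apply/subset_leq_card/subsetP => B.
  by rewrite !inE sub0set andbT.
have [|Ss [cS tS mS potS]] := IH.
  by apply: le_trans sV; rewrite ler_nat leq_mul2r ltnW ?orbT // ltnS.
have cardX : #|cover Ss| = (s * q ^ 2)%N.
  rewrite -(eqP tS) -cS -sum_nat_const; apply: eq_bigr => S SS.
  by case: (mS S SS).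
have Xsmall : (#|cover Ss| + q ^ 2)%:R <= zeta / 2 * #|V|%:R.
  rewrite cardX addnC -mulSn; apply: le_trans sV.
  by rewrite ler_nat leq_mul2r leqnSn orbT.
have q20 : (0 < q ^ 2)%N by rewrite expn_gt0 ltnW.
have [e eG eX] : exists2 e, e \in G & [disjoint e & cover Ss].
  apply: (exists_edge_avoiding q1 qG z0) => [v|].
    by have := common v v; rewrite setIid.
  apply: (@lt_le_trans _ _ (#|cover Ss| + q ^ 2)%:R).
    by rewrite ltr_nat -[X in (X < _)%N]addn0 ltn_add2l.
  apply: le_trans Xsmall _; rewrite ler_wpM2r //; lra.
pose beta B := (1 / 2 : R) ^+ #|absorbers G Ss B|.
have beta0 B : 0 <= beta B by apply: exprn_ge0; lra.
have [S [Sq SX mSS avg]] := absorber_step q1 qG z0 common Xsmall beta0 eG eX.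
have [|||tS' SnS] := @trivIsetU1 _ S Ss.
- move=> T TS; rewrite disjoint_sym; apply: disjointWl (_ : [disjoint cover Ss & S]).
    exact: bigcup_sup.
  by rewrite disjoint_sym.
- by [].
- by apply/negP => /mS[]; rewrite cards0 => q2; rewrite -q2 in q20.
exists (S |: Ss); split => //.
- by rewrite cardsU1 SnS cS.
- by move=> T /setU1P[->|/mS].
rewrite -/c exprS -mulrA.
apply: (@le_trans _ _ ((1 - c / 2) * \sum_(B : {set V} | #|B| == q) beta B)); last first.
  by rewrite ler_wpM2l //; lra.
have -> : \sum_(B : {set V} | #|B| == q) (1 / 2 : R) ^+ #|absorbers G (S |: Ss) B| =
    \sum_(B : {set V} | #|B| == q) beta B
    - 1 / 2 * \sum_(B : {set V} | (#|B| == q) && absorbs G S B) beta B.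
  rewrite big_mkcondr mulr_sumr -sumrB; apply: eq_bigr => B _.
  have -> : absorbers G (S |: Ss) B =
      if absorbs G S B then S |: absorbers G Ss B else absorbers G Ss B.
    apply/setP => T; rewrite !inE; case: ifP => aS; rewrite !inE.
      by have [->|] := eqVneq T S; rewrite ?aS.
    by have [->|] := eqVneq T S; rewrite ?aS ?andbF.
  case: ifP => _; last by rewrite mulr0 subr0.
  rewrite cardsU1 inE (negbTE SnS) /= exprS -/(beta B); lra.
move: avg; rewrite -/c; lra.
Qed.

(** * Perfect fractional matchings *)

(* In a copy [S] of [K_(q+1)], giving the edge [S :\ x] the extra weight [h S - g x],
   where [h S] is [1/q] times the sum of [g] over [S], raises the degree of each
   vertex [u] of [S] by exactly [g u]. *)
Lemma regularizing_weights (R : realFieldType) (V : finType) (H Ks : {set {set V}})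
    (A0 : {set V}) (q : nat) (D Delta K0 : R) :
  (0 < q)%N ->
  (forall S, S \in Ks ->
     [/\ #|S| = q.+1, S \subset A0 & forall x, x \in S -> S :\ x \in H]) ->
  (forall v, v \in A0 -> `|#|[set e in H | v \in e]|%:R - D| <= Delta) ->
  0 < K0 -> (forall v, v \in A0 -> K0 <= #|[set S in Ks | v \in S]|%:R) ->
  3 * #|A0|%:R * Delta <= K0 ->
  exists w : {set V} -> R,
    [/\ forall e, 0 <= w e <= 2, forall e, w e != 0 -> e \in H &
        forall v, v \in A0 -> wdeg w v = D].
Proof.
move=> q0 KsP degP K0_gt0 KvP small.
have qR : 0 < q%:R :> R by rewrite ltr0n.
pose deg v : R := #|[set e in H | v \in e]|%:R.
pose Kv v : R := #|[set S in Ks | v \in S]|%:R.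
pose g v := (D - deg v) / Kv v.
pose h (S : {set V}) := (\sum_(v in S) g v) / q%:R.
pose gamma := Delta / K0.
pose corr (e : {set V}) :=
  \sum_(S in Ks) \sum_(x in S) (h S - g x) * (e == S :\ x)%:R.
have g_le v : v \in A0 -> `|g v| <= gamma.
  move=> vA0; have Kv0 : 0 < Kv v := lt_le_trans K0_gt0 (KvP v vA0).
  rewrite /g /gamma normrM distrC normfV (gtr0_norm Kv0).
  apply: ler_pM; rewrite ?invr_ge0 ?(ltW Kv0) //; first exact: degP.
  by rewrite lef_pV2 ?posrE //; exact: KvP.
have hg_le S x : S \in Ks -> x \in S -> `|h S - g x| <= 3 * gamma.
  move=> /KsP[Sq /subsetP SA0 _] xS.
  have gx := g_le x (SA0 x xS).
  have gamma0 : 0 <= gamma := le_trans (normr_ge0 _) gx.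
  have : `|h S| <= 2 * gamma.
    rewrite /h normrM normfV (gtr0_norm qR) ler_pdivrMr //.
    apply: (le_trans (ler_norm_sum _ _ _)).
    apply: (@le_trans _ _ (\sum_(v in S) gamma)).
      by apply: ler_sum => v /SA0/g_le.
    rewrite sumr_const Sq -mulr_natl -natr1.
    have : 1 <= q%:R :> R by rewrite ler1n.
    nra.
  have := ler_normB (h S) (g x); lra.
(* For each [x] in [A0], only [S = x |: e] can contribute, so at most [#|A0|] terms of size at most
   [3 * gamma] occur. *)
have corr_le e : `|corr e| <= 1.
  apply: (@le_trans _ _ (#|A0|%:R * (3 * gamma))); last first.
    by rewrite /gamma !mulrA ler_pdivrMr // mul1r [_ * 3]mulrC.
  apply: le_trans (ler_norm_sum _ _ _) _.
  apply: (@le_trans _ _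
     (\sum_(x in A0) \sum_(S in Ks | x \in S) 3 * gamma * (S == x |: e)%:R)).
    rewrite (exchange_big_dep (mem Ks)) /=; last by move=> x S _ /andP[].
    apply: ler_sum => S SK; have [_ /subsetP SA0 _] := KsP S SK.
    apply: le_trans (ler_norm_sum _ _ _) _.
    rewrite [leRHS](eq_bigl (mem S)) => [|x]; last first.
      by rewrite SK /=; apply: andb_idl => /SA0.
    apply: ler_sum => x xS; rewrite normrM normr_nat.
    have [->|_] := eqVneq e (S :\ x).
      by rewrite setD1K // eqxx !mulr1 hg_le.
    rewrite mulr0 mulr_ge0 //; exact: le_trans (normr_ge0 _) (hg_le S x SK xS).
  have [->|A0n0] := eqVneq A0 set0; first by rewrite big_set0 cards0 mul0r.
  have gamma0 : 0 <= 3 * gamma.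
    have [v /g_le g1] := set0Pn _ A0n0; have := le_trans (normr_ge0 _) g1; lra.
  rewrite [leRHS]mulr_natl -sumr_const; apply: ler_sum => x _.
  rewrite -mulr_sumr; apply: ler_piMr => //.
  have [c|c] := boolP ((x |: e \in Ks) && (x \in x |: e)).
    rewrite (bigD1 (x |: e)) //= eqxx big1 ?addr0 // => S /andP[_ /negbTE->].
    by [].
  rewrite big1 // => S Sc; have [E|//] := eqVneq S (x |: e).
  by rewrite -E Sc in c.
exists (fun e => (e \in H)%:R + corr e); split.
- move=> e; have [eH|eH] := boolP (e \in H).
    have := corr_le e; rewrite ler_norml /= => /andP[? ?]; apply/andP; split; lra.
  rewrite /corr big1 ?addr0 ?lexx //= => S /KsP[_ _ SH].
  by rewrite big1 // => x /SH; have [<-|_ _] := eqVneq e (S :\ x);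
    rewrite ?(negbTE eH) ?mulr0.
- move=> e; apply: contraNT => eH; rewrite (negbTE eH) add0r.
  rewrite /corr big1 // => S /KsP[_ _ SH].
  by rewrite big1 // => x /SH; have [<-|_ _] := eqVneq e (S :\ x);
    rewrite ?(negbTE eH) ?mulr0.
move=> u uA0; have Ku0 : 0 < Kv u := lt_le_trans K0_gt0 (KvP u uA0).
rewrite /wdeg; under eq_bigr do rewrite mulrDl.
rewrite big_split /=.
have -> : \sum_(e : {set V}) (e \in H)%:R * (u \in e)%:R = deg u.
  rewrite /deg -sum1_card natr_sum [RHS]big_mkcond; apply: eq_bigr => e _ /=.
  by rewrite inE -natrM mulnb; case: (_ && _).
suff -> : \sum_e corr e * (u \in e)%:R = Kv u * g u.
  by rewrite /g mulrC divfK ?gt_eqF // addrC subrK.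
rewrite /corr; under eq_bigr do rewrite mulr_suml.
rewrite exchange_big /=.
have -> : Kv u * g u = \sum_(S in Ks) (u \in S)%:R * g u.
  rewrite -mulr_suml; congr (_ * _); rewrite /Kv -sum1_card natr_sum.
  rewrite big_mkcond [RHS]big_mkcond; apply: eq_bigr => S _ /=; rewrite inE.
  by case: (S \in Ks); case: (u \in S).
apply: eq_bigr => S SK; have [Sq _ _] := KsP S SK.
under eq_bigr do rewrite mulr_suml.
rewrite exchange_big /=.
have inner x : \sum_(e : {set V}) (h S - g x) * (e == S :\ x)%:R * (u \in e)%:R =
    (h S - g x) * (u \in S :\ x)%:R.
  rewrite (bigD1 (S :\ x)) //= eqxx mulr1 big1 ?addr0 // => e /negbTE->.
  by rewrite mulr0 mul0r.
under eq_bigr do rewrite inner.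
have [uS|uS] := boolP (u \in S); last first.
  by rewrite mul0r big1 // => x _; rewrite !inE (negbTE uS) andbF mulr0.
(* Inside [S] the vertex [u] gains [q h(S)] minus the sum of [g] over [S :\ u], and this is
   [g u]. *)
rewrite (bigD1 u) //= !inE eqxx mulr0 add0r mul1r.
rewrite (eq_bigr (fun x => h S - g x)); last first.
  by move=> x /andP[xS xu]; rewrite !inE uS eq_sym xu mulr1.
rewrite sumrB (_ : \sum_(x in S | x != u) h S = \sum_(v in S) g v); last first.
  rewrite (eq_bigl (mem (S :\ u))) => [|x]; last by rewrite !inE andbC.
  have cSu : #|S :\ u| = q by have := cardsD1 u S; rewrite Sq uS add1n => -[].
  by rewrite sumr_const cSu /h -[_ *+ q]mulr_natr divfK ?gt_eqF.
by rewrite (bigD1 u) //= addrK.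
Qed.

(** * Existence of a perfect matching *)

Lemma exists_exp_le (R : realType) (rho y : R) :
  0 <= rho < 1 -> 0 < y -> exists t : nat, rho ^+ t <= y.
Proof.
move=> /andP[rho0 rho1] y0; have x0 : 0 < 1 - rho by rewrite subr_gt0.
have [t /(_ t (leqnn t)) t_ge] := exists_nat_ge (y^-1 / (1 - rho)).
exists t; rewrite ler_pdivrMr // in t_ge.
apply: (@le_trans _ _ (expR (- (1 - rho)) ^+ t)).
  apply: lerXn2r; rewrite ?nnegrE ?expR_ge0 //.
  by have := expR_ge1Dx (- (1 - rho)); lra.
rewrite -expRM_natl mulrN expRN -[leRHS]invrK lef_pV2 ?posrE ?expR_gt0 ?invr_gt0 //.
by apply: le_trans t_ge _; have := expR_ge1Dx (t%:R * (1 - rho)); lra.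
Qed.

(** With [k] the quotient of [m] by [q + 1], [2^m] is at least [(k+1)^(q+1)]. The spare factor
    [k + 1] beats the constant [M]. *)
Lemma poly_lt_exp2 (q L : nat) :
  exists m0 : nat, forall m : nat, (m0 <= m)%N -> ((m.+1 * L) ^ q < 2 ^ m)%N.
Proof.
pose M := ((q.+1 * L) ^ q)%N.
exists (M * q.+1)%N => m; rewrite -leq_divRL // => Mk.
set k := (m %/ q.+1)%N in Mk.
have mk : (m.+1 <= q.+1 * k.+1)%N by rewrite mulnC ltn_ceil.
apply: (@leq_ltn_trans ((q.+1 * L) ^ q * k.+1 ^ q)%N).
  rewrite -expnMn; case: (q) mk => // p mk.
  by rewrite leq_exp2r // mulnAC leq_mul2r mk orbT.
apply: (@leq_trans (k.+1 ^ q.+1)%N).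
  by rewrite expnS ltn_pmul2r ?expn_gt0 // ltnS.
apply: (@leq_trans ((2 ^ k) ^ q.+1)%N); first by rewrite leq_exp2r // ltn_expl.
by rewrite -expnM leq_exp2l // leq_trunc_div.
Qed.

Lemma card_link_deg (V : finType) (G : {set {set V}}) (v : V) :
  #|link G v| = #|[set e in G | v \in e]|.
Proof.
rewrite -(@card_in_imset _ _ (fun f => v |: f)); last first.
  move=> f f'; rewrite !inE => /andP[vf _] /andP[vf' _] E.
  by rewrite -(setU1K vf) E setU1K.
apply: eq_card => e; rewrite inE; apply/imsetP/andP => [[f]|[eG ve]].
  by rewrite inE => /andP[_ fG] ->; rewrite fG setU11.
by exists (e :\ v); rewrite ?inE ?eqxx setD1K.
Qed.

(** As [v] is outside [X], each set has two distinct prescribed vertices, which saves a further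
    factor [n]. *)
Lemma card_mem_hitting_le (V : finType) (k : nat) (v : V) (X : {set V}) :
  v \notin X ->
  (#|[set S : {set V} | [&& #|S| == k, v \in S & ~~ [disjoint S & X]]]|
    <= #|X| * #|V| ^ k.-2)%N.
Proof.
move=> vX; apply: leq_trans (card_hitting_le k.-1 X).
rewrite -(@card_in_imset _ _ (fun S : {set V} => S :\ v)); last first.
  move=> S T; rewrite !inE => /and3P[_ vS _] /and3P[_ vT _] E.
  by rewrite -(setD1K vS) E setD1K.
apply/subset_leq_card/subsetP => _ /imsetP[S + ->].
rewrite !inE => /and3P[/eqP <- vS /pred0Pn[x /= /andP[xS xX]]].
rewrite (cardsD1 v S) vS eqxx; apply/pred0Pn; exists x.
by rewrite /= !inE xS xX !andbT; apply: contraNneq vX => <-.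
Qed.

Lemma exists_perfect_matching (R : realType) (q : nat) (zeta : R) :
  (1 < q)%N -> 0 < zeta ->
  exists n0 : nat, forall (V : finType) (G : {set {set V}}) (D : R),
  (n0 <= #|V|)%N -> (q %| #|V|)%N -> is_qgraph q G ->
  zeta * #|V|%:R ^+ q.-1 <= D ->
  (forall v : V, `|#|link G v|%:R - D| <= zeta / 50 * #|V|%:R ^+ q.-1) ->
  (forall v : V,
    zeta * #|V|%:R ^+ q <= #|[set S in complete_copies q G | v \in S]|%:R) ->
  (forall v w : V, zeta * #|V|%:R ^+ q.-1 <= #|link G v :&: link G w|%:R) ->
  matchable G [set: V].
Proof.
move=> q1 z0; have q0 : (0 < q)%N := ltnW q1.
have [z1|z1] := leP zeta 1; last first.
  (* For [zeta > 1] the hypotheses contradict each other on a nonempty vertex set, as a link has at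
     most [n^(q-1)] members. *)
  exists 1%N => V G D /card_gt0P[x _] _ qG _ _ _ /(_ x x); rewrite setIid => common.
  have V0 : 0 < #|V|%:R :> R by rewrite ltr0n (cardD1 x).
  have : zeta * #|V|%:R ^+ q.-1 <= 1 * #|V|%:R ^+ q.-1.
    by rewrite mul1r (le_trans common) // -natrX ler_nat card_link_le.
  by rewrite ler_pM2r ?exprn_gt0 // leNgt z1.
pose c := (zeta / 2) ^+ q; pose rho := 1 - c / 2.
have c0 : 0 < c by rewrite exprn_gt0 // divr_gt0.
have c1 : c <= 1 by rewrite exprn_ile1 // ?divr_ge0 ?(ltW z0) //; lra.
have [t rho_t] : exists t : nat, rho ^+ t <= 1 / 4.
  by apply: exists_exp_le; rewrite /rho; [apply/andP; split|]; lra.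
(* Absorbers will occupy at most [eps n] vertices. The degree deviation [zeta / 50] is [2 * eps] and
   grows to [3 * eps] on the rest. *)
pose eps := zeta / 100.
have eps0 : 0 < eps by rewrite divr_gt0.
(* With [m] about [n / L], the [t m] absorbers of [q^2] vertices each fit into [eps n] vertices. *)
have [L0 L0P] := exists_nat_ge (2 * (t * q ^ 2)%:R / eps).
pose L := maxn 1 L0.
have {L0P} LP : 2 * (t * q ^ 2)%:R <= eps * L%:R.
  by rewrite [leRHS]mulrC -ler_pdivrMr // L0P // leq_maxr.
have L0' : (0 < L)%N by rewrite leq_maxl.
have LR : 0 < L%:R :> R by rewrite ltr0n.
have [m0 m0P] := poly_lt_exp2 q L.
(* A leftover of [n / (2 L)] vertices is at most [m], within reach of the absorbers. *)
have [N0 nibble] := @almost_perfect_matching R q (2 / zeta) (1 / (2 * L%:R)) q1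
  (divr_ge0 (ler0n R 2) (ltW z0)) (divr_gt0 ltr01 (mulr_gt0 (ltr0n R 2) LR)).
have [n1 n1P] := exists_nat_ge (2 * (q ^ 2)%:R / eps).
have [n2 n2P] := exists_nat_ge (2 * N0%:R : R).
exists (maxn (maxn 1 (2 * L)) (maxn (m0 * L) (maxn n1 n2))) => V G D.
rewrite !geq_max => /and3P[/andP[V0 V2L] Vm0 /andP[/n1P Vn1 /n2P Vn2]].
move=> qV qG D_ge degP copiesP common.
set n : R := #|V|%:R in Vn1 Vn2 D_ge degP copiesP common *.
have n0 : 0 < n by rewrite ltr0n.
pose m := (#|V| %/ L)%N.
have mn : m%:R * L%:R <= n by rewrite -natrM ler_nat leq_trunc_div.
have nm : n <= 2 * m%:R * L%:R.
  have : (#|V| < m.+1 * L)%N by rewrite ltn_ceil.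
  rewrite /n -!natrM ler_nat mulSn -mulnA; move: V2L.
  by generalize #|V|, (m * L)%N, L; clear; lia.
have sV : ((t * m).+1 * q ^ 2)%:R <= eps * n.
  rewrite mulSn natrD mulnAC natrM.
  have : (t * q ^ 2)%:R * m%:R <= eps / 2 * n.
    apply: (@le_trans _ _ (eps / 2 * (m%:R * L%:R))); last first.
      by rewrite ler_wpM2l // divr_ge0 ?ltW.
    by rewrite [m%:R * _]mulrC mulrA ler_wpM2r //; lra.
  move: Vn1; rewrite ler_pdivrMr //; lra.
have z01 : 0 < zeta <= 1 by rewrite z0.
have sV2 : ((t * m).+1 * q ^ 2)%:R <= zeta / 2 * n.
  by apply: le_trans sV _; rewrite ler_pM2r // /eps; lra.
have [Ss [cS tS mS pot]] := absorbing_family q1 qG z01 common sV2.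
(* With fewer than [m] absorbers, the term of [B] alone would be at least [2^-m], but the whole
   potential is at most [4^-m n^q], which is smaller. *)
have manyS (B : {set V}) : #|B| = q -> (m <= #|absorbers G Ss B|)%N.
  move=> Bq; rewrite leqNgt; apply/negP => /ltnW few.
  have half0 : 0 < 1 / 2 :> R by lra.
  have half1 : 1 / 2 <= 1 :> R by lra.
  have : (1 / 2 : R) ^+ m <= (1 / 4) ^+ m * n ^+ q.
    apply: (@le_trans _ _ ((1 / 2) ^+ #|absorbers G Ss B|)).
      by rewrite ler_wiXn2l // ltW.
    apply: (@le_trans _ _ (rho ^+ (t * m) * n ^+ q)); last first.
      rewrite ler_wpM2r ?exprn_ge0 ?(ltW n0) // exprM lerXn2r ?nnegrE //; last by lra.
      by rewrite exprn_ge0 // /rho; lra.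
    apply: le_trans pot; rewrite (bigD1 B) ?Bq //= lerDl.
    by apply: sumr_ge0 => B' _; rewrite exprn_ge0 // ltW.
  rewrite leNgt => /negP; apply.
  have -> : 1 / 4 = 1 / 2 * (1 / 2) :> R by field.
  rewrite exprMn -mulrA -[ltRHS]mulr1 ltr_pM2l ?exprn_gt0 //.
  rewrite expr_div_n expr1n mul1r mulrC ltr_pdivrMr ?exprn_gt0 // mul1r.
  rewrite -!natrX ltr_nat; apply: leq_ltn_trans (m0P m _); last first.
    by rewrite leq_divRL.
  by case: (q) q0 => // p _; rewrite leq_exp2r // ltnW // ltn_ceil.
set X := cover Ss; pose A0 := ~: X.
have cardX : #|X| = (t * m * q ^ 2)%N.
  rewrite -(eqP tS) -cS -sum_nat_const; apply: eq_bigr => S SS.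
  by case: (mS S SS).
have X_le : #|X|%:R <= eps * n.
  by rewrite cardX; apply: le_trans sV; rewrite ler_nat leq_mul2r leqnSn orbT.
have cardA0 : #|A0|%:R = n - #|X|%:R :> R.
  by rewrite /n -(cardsC X) natrD addrC addKr.
have A0n : #|A0|%:R <= n by rewrite cardA0 lerBlDr lerDl.
have A0_ge : n / 2 <= #|A0|%:R.
  have : eps * n <= 1 / 2 * n by rewrite ler_pM2r // /eps; lra.
  rewrite cardA0; lra.
have A0_gt0 : 0 < #|A0|%:R :> R by apply: lt_le_trans A0_ge; rewrite divr_gt0.
have pow1 : n ^+ q = n * n ^+ q.-1 by rewrite -exprS prednK.
have pow2 : n ^+ q.-1 = n * n ^+ q.-2 by rewrite -exprS; case: (q) q1 => [|[]].
have nq1 : 0 < n ^+ q.-1 by rewrite exprn_gt0.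
have nq2 : 0 < n ^+ q.-2 by rewrite exprn_gt0.
have D0 : 0 < D by apply: lt_le_trans D_ge; rewrite mulr_gt0.
pose H := [set e in G | e \subset A0].
pose Ks := [set S in complete_copies q G | S \subset A0].
have nsub (S : {set V}) : (S \subset A0) = [disjoint S & X].
  by rewrite disjoints_subset.
have [w [w02 wH wD]] : exists w : {set V} -> R,
    [/\ forall e, 0 <= w e <= 2, forall e, w e != 0 -> e \in H &
        forall v, v \in A0 -> wdeg w v = D].
  apply: (@regularizing_weights R V H Ks A0 q D (3 * eps * n ^+ q.-1)
    ((zeta - eps) * n ^+ q)) => //.
  - move=> S; rewrite !inE => /andP[/andP[/eqP Sq /forallP SG] SA0].
    split=> // x xS; rewrite inE (subset_trans (subsetDl _ _) SA0) andbT.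
    apply: (implyP (SG _)); rewrite subsetDl /=.
    by move: Sq; rewrite (cardsD1 x) xS add1n => -[->].
  - move=> v; rewrite inE => vX.
    have := degP v; rewrite card_link_deg -(cardsID [set e : {set V} | e \subset A0]) natrD.
    have -> : [set e in G | v \in e] :&: [set e : {set V} | e \subset A0]
        = [set e in H | v \in e].
      by apply/setP => e; rewrite !inE andbAC.
    have : #|[set e in G | v \in e] :\: [set e : {set V} | e \subset A0]|%:R
        <= eps * n ^+ q.-1.
      apply: (@le_trans _ _ (#|X| * #|V| ^ q.-2)%:R).
        rewrite ler_nat; apply: leq_trans (card_mem_hitting_le q vX).
        apply/subset_leq_card/subsetP => e; rewrite !inE nsub.
        by move=> /andP[-> /andP[/qG-> ->]]; rewrite eqxx.
      by rewrite natrM natrX pow2 mulrA ler_pM2r.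
    rewrite !ler_norml /eps.
    have : 0 <= #|[set e in G | v \in e] :\: [set e : {set V} | e \subset A0]|%:R :> R by [].
    by move=> ? ? /andP[? ?]; apply/andP; split; lra.
  - by rewrite mulr_gt0 ?exprn_gt0 // /eps; lra.
  - move=> v; rewrite inE => vX.
    have := copiesP v; rewrite -(cardsID [set e : {set V} | e \subset A0]) natrD.
    have -> : [set S in complete_copies q G | v \in S] :&: [set e : {set V} | e \subset A0]
        = [set S in Ks | v \in S].
      by apply/setP => e; rewrite !inE andbAC.
    have : #|[set S in complete_copies q G | v \in S] :\: [set e : {set V} | e \subset A0]|%:R
        <= eps * n ^+ q.
      apply: (@le_trans _ _ (#|X| * #|V| ^ q.-1)%:R).
        rewrite ler_nat; apply: leq_trans (card_mem_hitting_le q.+1 vX).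
        apply/subset_leq_card/subsetP => e; rewrite !inE nsub.
        by move=> /andP[-> /andP[/andP[-> _] ->]].
      by rewrite natrM natrX pow1 mulrA ler_pM2r.
    lra.
  - apply: (@le_trans _ _ (3 * n * (3 * eps * n ^+ q.-1))).
      rewrite ler_pM2r ?mulr_gt0 //; lra.
    rewrite (_ : 3 * n * _ = 9 * eps * n ^+ q); last by rewrite pow1; ring.
    by rewrite ler_pM2r ?exprn_gt0 // /eps; lra.
have w0 e : 0 <= w e / D by have /andP[we _] := w02 e; rewrite divr_ge0 // ltW.
have [||||A [AA0 cardA mA]] := nibble V G A0 (fun e => w e / D) _ w0.
- by rewrite -(ler_nat R); lra.
- move=> e; rewrite mulf_eq0 negb_or => /andP[/wH + _].
  by rewrite inE => /andP[eG eA]; split=> //; apply: qG.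
- move=> v /wD; rewrite /wdeg => sumD.
  by under eq_bigr do rewrite mulrAC; rewrite -mulr_suml sumD divff // gt_eqF.
(* Normalised weights are at most [2 / D], and at most [n^(q-2)] edges contain both [u] and [v]. *)
- move=> u v uv; apply: (@le_trans _ _ (2 / zeta / n)); last first.
    by rewrite ler_wpM2l ?divr_ge0 ?(ltW z0) // lef_pV2 ?posrE.
  apply: (@le_trans _ _ (2 / D * n ^+ q.-2)); last first.
    have -> : 2 / zeta / n = 2 / (zeta * n ^+ q.-1) * n ^+ q.-2.
      by rewrite pow2; field; rewrite !gt_eqF.
    by rewrite ler_pM2r // ler_pM2l // lef_pV2 // posrE // mulr_gt0.
  apply: (@le_trans _ _
    (\sum_(e : {set V} | (#|e| == q) && ([set u; v] \subset e)) 2 / D)).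
    rewrite [leRHS]big_mkcond; apply: ler_sum => e _.
    have /andP[we0 we2] := w02 e.
    have [->|/wH] := eqVneq (w e) 0.
      by rewrite !mul0r; case: ifP => // _; rewrite divr_ge0 // ltW.
    rewrite inE => /andP[/qG-> _]; rewrite eqxx subUset !sub1set /=.
    case: (u \in e); case: (v \in e); rewrite /= ?mulr0 ?mul0r ?mulr1 //.
    by rewrite ler_pM2r ?invr_gt0.
  rewrite sumr_const -natrX mulr_natr ler_wpMn2l //; first by rewrite divr_ge0 // ltW.
  have := card_supersets_le q [set u; v].
  by rewrite cardsE cards2 uv subn2.
have mX : matchable G X by apply: matchable_cover => // S /mS[].
have A0E : A :|: (A0 :\: A) = A0 by rewrite -[RHS](setID A0 A) (setIidPr AA0).
have dA : [disjoint A0 :\: A & A] by rewrite disjoints_subset setDE subsetIr.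
(* The vertices outside [A] are tiled by edges, so divisibility of [n] by [q] passes to [#|A|]. *)
have qA : (q %| #|A|)%N.
  have cA : (#|A| + #|A0 :\: A| = #|A0|)%N by rewrite cardsD (setIidPr AA0) subnKC // subset_leq_card.
  rewrite -(dvdn_addl _ (matchable_dvdn qG mA)) cA.
  by rewrite -(dvdn_addr _ (matchable_dvdn qG mX)) cardsC.
have mAX : matchable G (A :|: X).
  apply: (@absorption V G Ss q (#|A| %/ q)) => //.
  - by move=> S /mS[].
  - by rewrite -nsub.
  - by rewrite mulnC divnK.
  move=> B _ Bq; apply: leq_trans (manyS B Bq).
  apply: leq_trans (leq_div _ _) _.
  rewrite -(ler_nat R); apply: le_trans cardA _.
  rewrite mul1r mulrC ler_pdivrMr ?mulr_gt0 //.
  by apply: le_trans A0n _; rewrite mulrA [_ * 2]mulrC.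
rewrite -(setUCr X) -/A0 -A0E setUA [X :|: A]setUC.
apply: matchableU mAX mA; rewrite disjoint_setUl disjoint_sym dA /=.
by rewrite disjoint_sym -nsub subsetDl.
Qed.

(** * Greedy removal of perfect matchings *)

Lemma card_link_setD (V : finType) (G E : {set {set V}}) (v : V) :
  E \subset G -> #|link G v| = (#|link (G :\: E) v| + #|link E v|)%N.
Proof.
move=> /subsetP EG; rewrite !card_link_deg -(cardsID E) addnC.
by congr (_ + _)%N; apply: eq_card => e; rewrite !inE;
  have [/EG->|] := boolP (e \in E); rewrite ?andbF ?andbT.
Qed.

Lemma card_common_link_setD (V : finType) (G E : {set {set V}}) (v w : V) :
  (#|link G v :&: link G w|
    <= #|link (G :\: E) v :&: link (G :\: E) w| + (#|link E v| + #|link E w|))%N.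
Proof.
apply: (@leq_trans #|(link (G :\: E) v :&: link (G :\: E) w)
    :|: (link E v :|: link E w)|).
  apply/subset_leq_card/subsetP => f; rewrite !inE.
  move=> /andP[/andP[-> ->] /andP[-> ->]] /=; rewrite !andbT.
  by case: (v |: f \in E); case: (w |: f \in E).
apply: leq_trans (leq_card_setU _ _) _; rewrite leq_add2l.
exact: (leq_of_leqif (leq_card_setU _ _)).
Qed.

(** A lost copy contains [v] and some [e] in [E]. The [k] edges through [v] spoil at most [n] copies
    each; any other edge determines the copy as [v |: e], and [E] has at most [k n] edges. *)
Lemma card_copies_setD (V : finType) (G E : {set {set V}}) (q k : nat) (v : V) :
  (0 < q)%N -> is_qgraph q E -> (forall u, #|link E u| = k) ->
  (#|[set S in complete_copies q G | v \in S]|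
    <= #|[set S in complete_copies q (G :\: E) | v \in S]| + 2 * (k * #|V|))%N.
Proof.
move=> q0 qE regE.
have degE u : (\sum_(e in E) (u \in e))%N = k.
  rewrite -(regE u) card_link_deg -sum1_card [LHS]big_mkcond [RHS]big_mkcond.
  by apply: eq_bigr => e _; rewrite inE; case: (e \in E); case: (u \in e).
have cE : (#|E| <= k * #|V|)%N.
  rewrite mulnC -sum_nat_const (eq_bigr (fun u => \sum_(e in E) (u \in e))%N); last first.
    by move=> u _; rewrite degE.
  rewrite exchange_big -sum1_card; apply: leq_sum => e /qE eq /=.
  rewrite -big_mkcond /= sum1_card; apply: leq_trans q0 _.
  by rewrite -eq; apply/subset_leq_card/subsetP.
pose lost := \bigcup_(e in E)
  [set S : {set V} | (#|S| == q.+1) && (v |: e \subset S)].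
apply: (@leq_trans #|[set S in complete_copies q (G :\: E) | v \in S] :|: lost|).
  apply/subset_leq_card/subsetP => S; rewrite !inE => /andP[/andP[Sq SG] vS].
  rewrite Sq vS !andbT /=.
  have [//|/forallPn[e]] := boolP [forall e : {set V},
    (e \subset S) && (#|e| == q) ==> (e \in G :\: E)].
  rewrite negb_imply => /andP[/andP[eS eq]]; rewrite inE negb_and negbK.
  have -> : e \in G by apply: (implyP (forallP SG e)); rewrite eS.
  rewrite orbF => eE; apply/bigcupP; exists e => //.
  by rewrite inE Sq subUset sub1set vS.
apply: leq_trans (leq_card_setU _ _) _; rewrite leq_add2l.
apply: (@leq_trans (\sum_(e in E) ((v \in e) * #|V| + 1))%N).
  rewrite /lost; elim/big_rec2: _ => [|e m S eE le_S]; first by rewrite cards0.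
  apply: leq_trans (leq_card_setU _ _) (leq_add _ le_S).
  apply: leq_trans (card_supersets_le _ _) _; rewrite cardsU1 (qE e eE).
  case: (v \in e) => /=; first by rewrite add0n subSnn expn1 mul1n addn1.
  by rewrite add1n subnn.
rewrite big_split -big_distrl degE sum_nat_const muln1 /= mul2n -addnn.
by rewrite leq_add2l.
Qed.

(** Each perfect matching has exactly one edge at [v], and edge-disjointness makes the counts add
    up. *)
Lemma card_link_perfect_matchings (V : finType) (G : {set {set V}})
    (F : {set {set {set V}}}) (v : V) :
  (forall M, M \in F -> is_perfect_matching G M) -> trivIset F ->
  #|link (cover F) v| = #|F|.
Proof.
move=> pmF tF; rewrite card_link_deg.
have -> : #|[set e in cover F | v \in e]| = (\sum_(e in cover F) (v \in e))%N.
  rewrite -sum1_card [LHS]big_mkcond [RHS]big_mkcond; apply: eq_bigr => e _.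
  by rewrite inE; case: (e \in cover F); case: (v \in e).
rewrite big_trivIset // -sum1_card; apply: eq_bigr => M /pmF[[_ tM] cM].
have /bigcupP[e eM ve] : v \in cover M by rewrite cM.
rewrite (bigD1 e) //= ve big1 ?addn0 // => f /andP[fM fe].
apply/eqP; rewrite eqb0; apply: contraNN fe => vf; apply/eqP.
by rewrite -(def_pblock tM fM vf) (def_pblock tM eM ve).
Qed.

Theorem theorem1p5 (R : realType) (q : nat) (hq : (2 <= q)%N)
    (xi : R) (hxi : 0 < xi) :
  exists n0 : nat, forall n : nat, (n0 <= n)%N -> (q %| n)%N ->
  forall (V : finType) (G : {set {set V}}), #|V| = n -> is_qgraph q G ->
  (exists2 d : R, xi <= d &
     forall v : V,
       (d - xi / 100%:R) * n%:R ^+ q.-1 <= #|link G v|%:R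
       /\ #|link G v|%:R <= (d + xi / 100%:R) * n%:R ^+ q.-1) ->
  (forall v : V,
     xi * n%:R ^+ q <= #|[set S in complete_copies q G | v \in S]|%:R) ->
  (forall v w : V,
     xi * n%:R ^+ q.-1 <= #|link G v :&: link G w|%:R) ->
  exists F : {set {set {set V}}},
    (forall M, M \in F -> is_perfect_matching G M)
    /\ trivIset F
    /\ xi / 100%:R * n%:R ^+ q.-1 <= #|F|%:R.
Proof.
have q0 : (0 < q)%N := ltnW hq.
have z0 : 0 < xi / 2 by rewrite divr_gt0.
have [n0 pm] := exists_perfect_matching hq z0.
exists (maxn 1 n0) => n; rewrite geq_max => /andP[n_gt0 n0n] qn V G cV qG.
subst n; move: (n_gt0); rewrite -(ltr0n R) => nR_gt0 [d d_ge degG] copiesG commonG.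
set n : R := #|V|%:R in nR_gt0 degG copiesG commonG *.
set b := xi / 100%:R * n ^+ q.-1.
have nq_gt0 : 0 < n ^+ q.-1 by rewrite exprn_gt0.
have nqE : n ^+ q = n ^+ q.-1 * n by rewrite -exprSr prednK.
have xn_gt0 : 0 < xi * n ^+ q.-1 by rewrite mulr_gt0.
(* The least integer [k >= b] satisfies [k < b + 1]; the bound lets every extension start from fewer
   than [b] matchings. *)
suff build (k : nat) : k%:R < b + 1 -> exists F : {set {set {set V}}},
    [/\ #|F| = k, forall M, M \in F -> is_perfect_matching G M & trivIset F].
  have ex_k : exists k : nat, b <= k%:R.
    by have [k kP] := exists_nat_ge b; exists k; apply: kP.
  case: (ex_minnP ex_k) => k bk kmin.
  have [|F [cF pmF tF]] := build k; last by exists F; split; rewrite ?cF.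
  case: k bk kmin => [|k] bk kmin.
    by rewrite ltr_wpDl // mulr_ge0 ?divr_ge0 ?exprn_ge0 ?ltW.
  rewrite -natr1 ltrD2r ltNge; apply/negP => /kmin; by rewrite ltnn.
elim: k => [_|k IH].
  exists set0; split; rewrite ?cards0 //; first by move=> M; rewrite inE.
  by apply/trivIsetP => A B; rewrite inE.
rewrite -natr1 ltrD2r => kb.
have [|F [cF pmF tF]] := IH; first by rewrite (lt_trans kb) // ltrDl.
pose E := cover F.
have EG : E \subset G by apply/bigcupsP => M /pmF[[]].
have qE : is_qgraph q E by move=> e /(subsetP EG)/qG.
have regE u : #|link E u| = k by rewrite (card_link_perfect_matchings u pmF tF).
have : matchable (G :\: E) [set: V].
  (* The centre of the degrees drops by [k] and their deviation stays [xi / 100], which is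
     [(xi / 2) / 50]. Copies and common links lose at most twice [xi / 100] of their scale. *)
  apply: (pm V (G :\: E) (d * n ^+ q.-1 - k%:R)) => //.
  - by move=> e; rewrite inE => /andP[_ /qG].
  - have : xi * n ^+ q.-1 <= d * n ^+ q.-1 by rewrite ler_pM2r.
    by move: kb; rewrite -/n /b; lra.
  - move=> v; have := degG v; rewrite (card_link_setD v EG) regE natrD ler_norml.
    by rewrite -/n => -[? ?]; apply/andP; split; lra.
  - move=> v; have := card_copies_setD G v q0 qE regE; rewrite -(ler_nat R) => le_c.
    have := le_trans (copiesG v) le_c; rewrite -/n natrD !natrM nqE.
    have : k%:R * n <= b * n by rewrite ler_pM2r // ltW.
    by have := mulr_gt0 xn_gt0 nR_gt0; rewrite /b; lra.
  - move=> v w; have := card_common_link_setD G E v w; rewrite -(ler_nat R) => le_c.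
    have := le_trans (commonG v w) le_c; rewrite -/n !natrD !regE.
    by move: kb; rewrite /b; lra.
case/matchableP => M [MGE tM cM].
have pmM : is_perfect_matching G M.
  by split=> //; split=> //; apply: subset_trans MGE (subsetDl _ _).
have ME : [disjoint M & E].
  by rewrite disjoints_subset (subset_trans MGE) // setDE subsetIr.
have [|||tMF MF] := @trivIsetU1 _ M F => //.
- move=> N NF; apply: disjointWr ME; exact: bigcup_sup.
(* On a nonempty vertex set the empty matching is not perfect, so the disjoint [M] is really new in
   [F]. *)
- have /card_gt0P[x _] := n_gt0; apply/negP => /pmF[_].
  by rewrite /cover big_set0 => /setP/(_ x); rewrite !inE.
exists (M |: F); split=> //; first by rewrite cardsU1 MF cF.
by move=> N /setU1P[->|/pmF].
Qed.
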